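(* There is an absolute constant $C>0$ such that for every $[Z] \in \mathrm{Hilb}^2(\mathbb{P}^2)(\mathbb{Z})$, $$|\mathrm{Disc}(Z)| \le C \cdot H_{-2,2}([Z]),$$ where $\mathrm{Disc}(Z) := \mathrm{Disc}(H^0(Z, \mathcal{O}_Z))$ is the discriminant of the quadratic ring of regular functions on $Z$.
   Context: $\mathrm{Hilb}^2(\mathbb{P}^2)(\mathbb{Z})$ is the set of $\mathbb{Z}$-flat closed subschemes $Z \subset \mathbb{P}^2_{\mathbb{Z}}$ all of whose fibers over $\mathrm{Spec}(\mathbb{Z})$ have dimension $0$ and degree $2$. For such $Z$, the ring $H^0(Z,\mathcal{O}_Z)$ is a quadratic ring, i.e. free of rank $2$ as a $\mathbb{Z}$-module. Let $S_{\mathbb{Z}}(d)$ be the lattice of homogeneous degree $d$ polynomials in $\mathbb{Z}[X_0,X_1,X_2]$ and $I_Z(d) \subset S_{\mathbb{Z}}(d)$ the sublattice of polynomials vanishing on $Z$. Equip $S_{\mathbb{Z}}(d) \otimes \mathbb{R}$ with the inner product for which the monomials are an orthonormal basis; the covolume of a sublattice with basis $w_1,\dots,w_k$ is $\det(\langle w_i,w_j\rangle)^{1/2}$. For $s,t \in \mathbb{R}$, $H_{s,t}([Z]) = (\mathrm{covol}\, I_Z(1))^{s-t} (\mathrm{covol}\, I_Z(2))^{t}$; thus $H_{-2,2}([Z]) = (\mathrm{covol}\, I_Z(2))^2/(\mathrm{covol}\, I_Z(1))^4$. *)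

(* Defs.v *)
From HB Require Import structures.
From mathcomp Require Import all_boot all_order all_algebra.
From mathcomp Require Import mpoly.
From mathcomp Require Import boolp classical_sets reals.
From mathcomp Require exp.

Set Implicit Arguments.
Unset Strict Implicit.
Unset Printing Implicit Defensive.

Import Order.TTheory GRing.Theory Num.Theory.
Local Open Scope classical_set_scope.
Local Open Scope ring_scope.

Section Ideals.
Variable A : comNzRingType.

(* The unit ideal is allowed. *)
Definition is_ideal (I : set A) : Prop :=
  [/\ I 0, forall f g, I f -> I g -> I (f + g) & forall a f, I f -> I (a * f)].

Definition is_prime_ideal (P : set A) : Prop :=
  [/\ is_ideal P, ~ P 1 & forall f g, P (f * g) -> P f \/ P g].

End Ideals.

(* w is a basis of the quotient module L / N. *)
Definition is_quot_basis (R : nzRingType) (V : lmodType R) (L N : set V)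
    (n : nat) (w : 'I_n -> V) : Prop :=
  (forall i, L (w i)) /\
  (forall v, L v -> exists! a : 'rV[R]_n, N (v - \sum_i a 0 i *: w i)).

Section ClosedSubschemes.
Variable R : comNzRingType.

(* The coordinate ring of the chart U_i = {X_i <> 0} of P^2_R is
   R[X_0,X_1,X_2] / (X_i - 1), where X_j stands for X_j / X_i.  A quasi-coherent
   ideal sheaf is given by its ideal of sections on each U_i, and that ideal is
   recorded as its preimage in R[X_0,X_1,X_2], which contains X_i - 1. *)
Definition chart_ideals := 'I_3 -> set {mpoly R[3]}.

(* Let F be homogeneous of degree a + b.  The element F / (X_i^a X_j^b) of the
   coordinate ring of U_i \cap U_j lies in the extension of Z i if and only if
   vanishes_on_overlap Z i j F holds: on U_i the overlap is the locus where X_j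
   is inverted. *)
Definition vanishes_on_overlap (Z : chart_ideals) (i j : 'I_3)
    (F : {mpoly R[3]}) : Prop :=
  exists n : nat, Z i ('X_j ^+ n * F).

Definition is_closed_subscheme (Z : chart_ideals) : Prop :=
  [/\ forall i, is_ideal (Z i),
      forall i, Z i ('X_i - 1)
    & forall (i j : 'I_3) (d : nat) (F : {mpoly R[3]}), F \is d.-homog ->
        vanishes_on_overlap Z i j F <-> vanishes_on_overlap Z j i F].

(* Functions f on Z \cap U_i and g on Z \cap U_j have equal restrictions to
   Z \cap U_i \cap U_j.  One writes f = F / X_i^d and g = G / X_j^d with F and G
   homogeneous of the same degree d. *)
Definition agree_on_overlap (Z : chart_ideals) (i j : 'I_3)
    (f g : {mpoly R[3]}) : Prop :=
  exists (d : nat) (F G : {mpoly R[3]}),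
    [/\ F \is d.-homog, G \is d.-homog, Z i (f - F), Z j (g - G)
      & vanishes_on_overlap Z i j ('X_j ^+ d * F - 'X_i ^+ d * G)].

(* H^0(Z, O_Z) is the quotient of sections by null_sections, with the
   componentwise operations. *)
Definition sections (Z : chart_ideals) : set {ffun 'I_3 -> {mpoly R[3]}} :=
  [set s | forall i j, agree_on_overlap Z i j (s i) (s j)].

Definition null_sections (Z : chart_ideals) :
    set {ffun 'I_3 -> {mpoly R[3]}} :=
  [set s | forall i, Z i (s i)].

Definition section_mul (s t : {ffun 'I_3 -> {mpoly R[3]}}) :
    {ffun 'I_3 -> {mpoly R[3]}} :=
  [ffun i => s i * t i].

Definition is_H0_basis (Z : chart_ideals) (n : nat)
    (w : 'I_n -> {ffun 'I_3 -> {mpoly R[3]}}) : Prop :=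
  is_quot_basis (sections Z) (null_sections Z) w.

(* T i j is the matrix of multiplication by w_i w_j on H^0(Z, O_Z), so that D is
   the determinant of the trace form. *)
Definition is_trace_form_det (Z : chart_ideals) (n : nat)
    (w : 'I_n -> {ffun 'I_3 -> {mpoly R[3]}}) (D : R) : Prop :=
  exists T : 'I_n -> 'I_n -> 'M[R]_n,
    (forall i j l, null_sections Z
       (section_mul (section_mul (w i) (w j)) (w l)
        - \sum_m T i j l m *: w m)) /\
    D = \det (\matrix_(i, j) \tr (T i j)).

End ClosedSubschemes.

Section Fibers.
Variable k : fieldType.

(* All charts have Krull dimension at most 0.  The empty subscheme is excluded
   by the degree condition below. *)
Definition has_dim0 (Y : chart_ideals k) : Prop :=
  forall (i : 'I_3) (P Q : set {mpoly k[3]}),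
    is_prime_ideal P -> is_prime_ideal Q -> Y i `<=` P -> P `<=` Q -> P = Q.

Definition has_degree (Y : chart_ideals k) (n : nat) : Prop :=
  exists w : 'I_n -> {ffun 'I_3 -> {mpoly k[3]}}, is_H0_basis Y w.

Definition fiber (Z : chart_ideals int) : chart_ideals k :=
  fun i => smallest (@is_ideal {mpoly k[3]})
             (map_mpoly (intr : int -> k) @` Z i).

End Fibers.
Arguments fiber : clear implicits.

(* A module over the principal ideal domain Z is flat iff it is torsion-free. *)
Definition is_flat (Z : chart_ideals int) : Prop :=
  forall (i : 'I_3) (m : int) (f : {mpoly int[3]}),
    m != 0 -> Z i (m *: f) -> Z i f.

(* The residue fields of Spec(Z) are rat, at the generic point, and the 'F_p. *)
Definition Hilb2P2 : set (chart_ideals int) :=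
  [set Z | [/\ is_closed_subscheme Z, is_flat Z,
               has_dim0 (fiber rat Z) /\ has_degree (fiber rat Z) 2
             & forall p : nat, prime p ->
                 has_dim0 (fiber 'F_p Z) /\ has_degree (fiber 'F_p Z) 2]].

(* The discriminant of H^0(Z, O_Z), which does not depend on the basis.  The
   default 0 is not used when Z is in Hilb2P2. *)
Definition Disc (Z : chart_ideals int) : int :=
  xget 0 [set D | exists w : 'I_2 -> {ffun 'I_3 -> {mpoly int[3]}},
                    is_H0_basis Z w /\ is_trace_form_det Z w D].

(* A form F of degree d vanishes on Z iff F / X_i^d vanishes on Z \cap U_i for
   every i. *)
Definition vanishing_forms (Z : chart_ideals int) (d : nat) :
    set {mpoly int[3]} :=
  [set F | F \is d.-homog /\ forall i, Z i F].

(* The inner product for which the monomials are orthonormal. *)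
Definition mono_dot (f g : {mpoly int[3]}) : int :=
  \sum_(m <- msupp f) f@_m * g@_m.

(* Independent of the basis.  The default 0 is not used when L is a subgroup of
   the forms of some degree; the zero lattice has covolume 1. *)
Definition covol (R : realType) (L : set {mpoly int[3]}) : R :=
  xget 0 [set c | exists (n : nat) (w : 'I_n -> {mpoly int[3]}),
    is_quot_basis L [set 0] w /\
    c = Num.sqrt (\det (\matrix_(i, j) mono_dot (w i) (w j)))%:~R].

Arguments covol : clear implicits.

Definition height (R : realType) (s t : R) (Z : chart_ideals int) : R :=
  exp.powR (covol R (vanishing_forms Z 1)) (s - t)
  * exp.powR (covol R (vanishing_forms Z 2)) t.

(* Main.v *)
Require Import Defs.
From HB Require Import structures.
From mathcomp Require Import all_boot all_order all_fingroup all_algebra.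
From mathcomp Require Import mpoly ssrcomplements.
From mathcomp Require Import boolp classical_sets reals exp.
From mathcomp Require Import ring lra zify.
Import Order.TTheory GRing.Theory Num.Theory.
Local Open Scope ring_scope.

(** Geometrically, Z lies on a unique line lin l = 0 with l a primitive integral
    vector, and on this line it is cut out by a quadratic form q.  The linear forms
    vanishing on Z are the multiples of lin l, and the quadratic ones have the
    basis lin l * X_0, lin l * X_1, lin l * X_2, q.  So the two covolumes are |l|
    and the square root of the Gram determinant g of these four forms.  Let Delta
    be the discriminant of q on the line, computed for the area form given by l
    ([line_disc]).  The theorem follows from two estimates.

    First, |Disc Z| <= 4 |Delta| ([disc_le]).  On the chart X_i <> 0 the
    i-th coordinate of the cross product of the gradient of q with l, divided by X_i,
    defines a function; these functions agree modulo lin l and q, so they form a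
    global section delta, and delta^2 = Delta.  The subring spanned by 1 and delta has
    discriminant 4 Delta, which is Disc Z times the square of an integer.

    Second, |l|^4 |Delta| <= 1296 g ([conic_gram_ge], applied to the largest
    coordinate l_k, for which |l|^2 <= 3 l_k^2).  By the Cauchy-Binet formula, g is
    at least, up to a constant, the square of each 4 x 4 minor of the coefficient
    matrix.  Three of the minors are l_k times the coefficients A, B, C of the binary
    form that results from q by eliminating X_k ([red]), and
    B^2 - 4 A C = l_k^2 Delta.

    The structure of the vanishing forms is derived from two properties of Z:
    its generic fibre has dimension zero, and H^0(Z, O_Z) has rank 2.  (If it has no
    basis of two elements over the integers, Disc Z is 0 by convention.)
    Dimension zero means that, over the rationals, for each linear form h the ideals
    h^n of a chart become stationary ([dim0_power_stable]), so that Z splits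
    into a part where h is invertible and a part where h is nilpotent, and a form
    of degree d divided by h^d is a section on the first part, extended by zero
    ([fraction_section]).  Counting such sections against the rank 2 yields a
    linear form h that is invertible on all of Z ([regular_form_exists]).
    Dividing by powers of h bounds by 2 the rank of the forms of each degree modulo
    those vanishing on Z; this gives a line and a conic through Z.  There are no more
    of them: two lines would make Z a single reduced point, for which H^0 has
    rank 1 ([coordinates_not_proportional]), and multiplication by h embeds the
    linear forms modulo the vanishing ones into the quadratic ones
    ([vanishing_conics_parallel]).  Gauss's lemma makes the basis of the
    quadratic forms integral. *)

Set Implicit Arguments.
Unset Strict Implicit.
Unset Printing Implicit Defensive.
Local Open Scope classical_set_scope.

(** * Zero-dimensional rings *)

Section ZeroDimensional.
Variable A : comNzRingType.
Implicit Types (I J P S : set A) (x : A).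

Lemma ideal_opp I a : is_ideal I -> I a -> I (- a).
Proof. by case=> _ _ IM Ia; rewrite -mulN1r; apply: IM. Qed.

Lemma ideal_sub I a b : is_ideal I -> I a -> I b -> I (a - b).
Proof. by move=> II Ia Ib; case: (II) => _ ID _; apply: ID => //; apply: ideal_opp. Qed.

(** An ideal that is maximal among those disjoint from the multiplicative set
    S is prime: if it contained neither f nor g, the two larger ideals obtained
    by adjoining f and g would meet S, and the product of the two meeting points
    would be in S and, as f * g is in the ideal, in the ideal. *)
Lemma prime_ideal_avoiding S J :
  S 1 -> (forall a b, S a -> S b -> S (a * b)) ->
  is_ideal J -> (forall a, J a -> ~ S a) ->
  exists P, [/\ is_prime_ideal P, J `<=` P & forall a, P a -> ~ S a].
Proof.
move=> S1 SM idJ JS.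
pose good K := [/\ is_ideal K, J `<=` K & forall a, K a -> ~ S a].
(* The union of the empty chain is empty, hence the first alternative. *)
have [F Fgood Ftot|P [[->|[idP JP PS]] Pmax]] :=
  @Zorn_bigcup A [set K | K = set0 \/ good K].
- have [|/existsNP[K0 /not_implyP[FK0 /eqP/set0P[a0 K0a0]]]] :=
    pselect (forall K, F K -> K = set0).
    by move=> F0; left; rewrite bigcup0.
  have gK K a : F K -> K a -> good K.
    by move=> FK Ka; have [K_0|//] := Fgood _ FK; rewrite K_0 in Ka.
  have [[K00 _ _] JK0 _] := gK _ _ FK0 K0a0.
  right; split; last by move=> a [K FK Ka]; have [_ _] := gK _ _ FK Ka; apply.
    split; first by exists K0.
      move=> f g [K FK Kf] [L FL Lg].
      have [KL|LK] := Ftot _ _ FK FL.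
        by exists L => //; have [[_ LD _] _ _] := gK _ _ FL Lg; apply/LD/Lg/KL.
      by exists K => //; have [[_ KD _] _ _] := gK _ _ FK Kf; apply/KD/LK.
    move=> a f [K FK Kf]; exists K => //.
    by have [[_ _ KM] _ _] := gK _ _ FK Kf; apply: KM.
  by move=> a /JK0 K0a; exists K0.
- exfalso; apply: (Pmax J); last by right; split.
  split; first by [].
  by move=> /(_ 0); case: (idJ) => J0 _ _; apply.
exists P; split=> //; case: (idP) => P0 PD PM.
split=> //; first by move=> /PS; apply.
(* Adjoining to P an element outside P yields an ideal that meets S. *)
have meet x : ~ P x -> exists p a, P p /\ S (p + a * x).
  move=> nPx; apply: contrapT => noS.
  apply: (Pmax [set y | exists p a, P p /\ y = p + a * x]).
    split; first by move=> p Pp; exists p, 0; rewrite mul0r addr0.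
    by move=> /(_ x) sub; apply/nPx/sub; exists 0, 1; rewrite mul1r add0r.
  right; split.
  - split; first by exists 0, 0; rewrite mul0r addr0.
      move=> _ _ [p [a [Pp ->]]] [q [b [Pq ->]]].
      by exists (p + q), (a + b); split; [apply: PD|rewrite mulrDl addrACA].
    move=> c _ [p [a [Pp ->]]].
    by exists (c * p), (c * a); split; [apply: PM|rewrite mulrDr mulrA].
  - by move=> y /JP Py; exists y, 0; rewrite mul0r addr0.
  by move=> _ [p [a [Pp ->]]] Sy; apply: noS; exists p, a.
move=> f g Pfg; apply: contrapT => /not_orP[/meet[p [a [Pp Sf]]] /meet[q [b [Pq Sg]]]].
apply: PS (SM _ _ Sf Sg).
have -> : (p + a * f) * (q + b * g) = (q + b * g) * p + (a * f) * q + (a * b) * (f * g).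
  by ring.
apply: (PD _ _ (PD _ _ (PM _ _ Pp) (PM _ _ Pq)) (PM _ _ Pfg)).
Qed.

(** If no such n and r exist, some prime P over J avoids the multiplicative set of
    all x^n (1 - x r), hence contains neither x nor any 1 - x r; then P + (x) is
    proper and lies in a prime larger than P.  The conclusion says that the powers
    of the ideal (x) become stationary modulo J. *)
Lemma dim0_power_stable J x :
  is_ideal J ->
  (forall P Q, is_prime_ideal P -> is_prime_ideal Q -> J `<=` P -> P `<=` Q -> P = Q) ->
  exists n r, J (x ^+ n * (1 - x * r)).
Proof.
move=> idJ dim0; apply: contrapT => nJ.
pose S := [set y | exists n r, y = x ^+ n * (1 - x * r)].
have [|a b [n [r ->]] [m [s ->]]|//|a Ja [n [r ar]]|P [prP JP PS]] :=
  @prime_ideal_avoiding S J.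
- by exists 0%N, 0; rewrite expr0 mulr0 subr0 mulr1.
- by exists (n + m)%N, (r + s - x * r * s); rewrite exprD; ring.
- by apply: nJ; exists n, r; rewrite -ar.
have [[P0 PD PM] P1 _] := prP.
have [||||Q [prQ PQ _]] :=
  @prime_ideal_avoiding [set 1] [set y | exists p a, P p /\ y = p + a * x].
- by [].
- by move=> _ _ -> ->; rewrite mulr1.
- split; first by exists 0, 0; rewrite mul0r addr0.
    move=> _ _ [p [a [Pp ->]]] [q [b [Pq ->]]].
    by exists (p + q), (a + b); split; [apply: PD|rewrite mulrDl addrACA].
  move=> c _ [p [a [Pp ->]]].
  by exists (c * p), (c * a); split; [apply: PM|rewrite mulrDr mulrA].
- move=> _ [p [a [Pp ->]]] /= pax; apply: (PS p Pp); exists 0%N, a.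
  by rewrite expr0 mul1r -pax; ring.
have eqPQ : P = Q.
  by apply: dim0 => // p Pp; apply: PQ; exists p, 0; rewrite mul0r addr0.
apply: (PS x); last by exists 1%N, 0; rewrite expr1 mulr0 subr0 mulr1.
by rewrite eqPQ; apply: PQ; exists 0, 1; rewrite mul1r add0r.
Qed.

End ZeroDimensional.

(** * Integral linear algebra *)

Lemma int_rows_dependent n (U : 'M[int]_(1 + n, n)) :
  exists2 c : 'rV[int]_(1 + n), c != 0 & c *m U = 0.
Proof.
have /det0P[c c0 cU] : \det (row_mx (0 : 'cV_(1 + n)) U) == 0.
  rewrite -det_tr tr_row_mx; apply/det0P; exists (delta_mx 0 (lshift n 0)).
    by apply/eqP => /matrixP/(_ 0 (lshift n 0)); rewrite !mxE !eqxx.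
  by rewrite -rowE rowKu trmx0; apply/rowP=> j; rewrite !mxE.
exists c => //; move: cU; rewrite mul_mx_row => /eqP; rewrite row_mx_eq0.
by case/andP=> _ /eqP.
Qed.

(** Euclidean division: an element g of L at which phi has the least nonzero
    absolute value generates L modulo the kernel of phi. *)
Lemma cyclic_mod_kernel (V : lmodType int) (L : set V) (phi : V -> int) v0 :
  (forall u c v, phi (u - c *: v) = phi u - c * phi v) ->
  (forall u c v, L u -> L v -> L (u - c *: v)) ->
  L v0 -> phi v0 != 0 ->
  exists g, [/\ L g, phi g != 0 &
                forall v, L v -> exists c : int, phi (v - c *: g) = 0].
Proof.
move=> phiB LB Lv0 phi0.
have ex : exists n, `[< exists v, [/\ L v, phi v != 0 & `|phi v|%N = n] >].
  by exists `|phi v0|%N; apply/asboolP; exists v0.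
case: (ex_minnP ex) => n /asboolP[g [Lg g0 gn]] nmin.
exists g; split=> // v Lv; exists (phi v %/ phi g)%Z.
apply/eqP/negPn/negP => r0.
set r := v - _ in r0; have Lr : L r by exact: LB.
have /nmin : `[< exists u, [/\ L u, phi u != 0 & `|phi u|%N = `|phi r|%N] >].
  by apply/asboolP; exists r.
have -> : phi r = (phi v %% phi g)%Z.
  by rewrite phiB {1}[phi v](divz_eq _ (phi g)) addrAC subrr add0r.
have := ltz_mod (phi v) g0; have := modz_ge0 (phi v) g0; rewrite -gn; lia.
Qed.

(** * Gram determinants *)

(** The Cauchy-Binet formula, in the form that sums over all n-tuples f of
    columns; each set of n columns then occurs n! times, and tuples with a
    repetition contribute zero. *)
Lemma gram_det_sum_sqr (R : comNzRingType) (T : finType) n (v : 'I_n -> T -> R) :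
  \det (\matrix_(i, j) \sum_t v i t * v j t) *+ n`! =
  \sum_(f : {ffun 'I_n -> T}) \det (\matrix_(i, j) v i (f j)) ^+ 2.
Proof.
pose N (f : {ffun 'I_n -> T}) := \matrix_(i, j) v i (f j).
pose D (f : {ffun 'I_n -> T}) := (\prod_i v i (f i)) * \det (N f).
have -> : \det (\matrix_(i, j) \sum_t v i t * v j t) = \sum_(f : {ffun 'I_n -> T}) D f.
  transitivity (\sum_(f : {ffun 'I_n -> T}) \sum_(s : 'S_n)
      (\prod_i v i (f i)) * ((-1) ^+ s * \prod_i v (s i) (f i))).
    rewrite exchange_big; apply: eq_bigr => s _ /=.
    under eq_bigr do rewrite mxE.
    rewrite (bigA_distr_bigA (fun i t => v i t * v (s i) t)) mulr_sumr.
    by apply: eq_bigr => f _; rewrite big_split /= mulrCA.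
  apply: eq_bigr => f _; rewrite -mulr_sumr /D -(det_tr (N f)); congr (_ * _).
  apply: eq_bigr => s _; congr (_ * _).
  by apply: eq_bigr => i _; rewrite !mxE.
transitivity (\sum_(s : 'S_n) \sum_(f : {ffun 'I_n -> T}) D f).
  by rewrite sumr_const card_Sn.
transitivity (\sum_(s : 'S_n) \sum_(f : {ffun 'I_n -> T})
    (-1) ^+ s * (\prod_i v i (f (s i))) * \det (N f)).
  apply: eq_bigr => s _.
  pose h (f : {ffun 'I_n -> T}) := [ffun i => f (s i)] : {ffun 'I_n -> T}.
  have hK : bijective h.
    exists (fun f : {ffun 'I_n -> T} => [ffun i => f (s^-1 i)%g]) => f;
    by apply/ffunP=> i; rewrite !ffunE ?permK ?permKV.
  rewrite (reindex h) /=; last exact: onW_bij.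
  apply: eq_bigr => f _; rewrite /D.
  have -> : N (h f) = col_perm s (N f) by apply/matrixP=> i j; rewrite !mxE ffunE.
  rewrite col_permE det_mulmx det_perm odd_permV.
  have -> : \prod_i v i (h f i) = \prod_i v i (f (s i)).
    by apply: eq_bigr => i _; rewrite ffunE.
  by rewrite mulrA mulrC mulrA.
rewrite exchange_big; apply: eq_bigr => f _ /=.
rewrite -mulr_suml expr2; congr (_ * _).
by apply: eq_bigr => s _; congr (_ * _); apply: eq_bigr => i _; rewrite mxE.
Qed.

(** * Independence of the covolume from the basis *)

Lemma mono_dotE k (f g : {mpoly int[3]}) : (msize f <= k)%N ->
  mono_dot f g = \sum_(m : 'X_{1..3 < k}) f@_m * g@_m.
Proof.
move=> lek; rewrite /mono_dot (big_mksub 'X_{1..3 < k}) //=; first last.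
- by move=> m /msize_mdeg_lt /leq_trans; apply.
- exact: msupp_uniq.
by rewrite big_rmcond // => m /memN_msupp_eq0 ->; rewrite mul0r.
Qed.

Lemma mono_dotC (f g : {mpoly int[3]}) : mono_dot f g = mono_dot g f.
Proof.
rewrite !(@mono_dotE (maxn (msize f) (msize g))) ?leq_maxl ?leq_maxr //.
by apply: eq_bigr => m _; rewrite mulrC.
Qed.

Lemma mono_dot_sumr (I : finType) (f : {mpoly int[3]}) (a : I -> int) w :
  mono_dot f (\sum_i a i *: w i) = \sum_i a i * mono_dot f (w i).
Proof.
rewrite /mono_dot; under [RHS]eq_bigr do rewrite mulr_sumr.
rewrite exchange_big; apply: eq_bigr => m _ /=.
rewrite raddf_sum mulr_sumr; apply: eq_bigr => i _.
by rewrite /= mcoeffZ mulrCA.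
Qed.

Definition gram n (w : 'I_n -> {mpoly int[3]}) : 'M[int]_n :=
  \matrix_(i, j) mono_dot (w i) (w j).

Lemma gram_base_change m n (P : 'M[int]_(m, n)) w :
  gram (fun i => \sum_k P i k *: w k) = P *m gram w *m P^T.
Proof.
apply/matrixP=> i j; rewrite !mxE mono_dot_sumr; apply: eq_bigr => k _.
rewrite mxE mulrC mono_dotC mono_dot_sumr !mxE; congr (_ * _).
by apply: eq_bigr => l _; rewrite mono_dotC mxE.
Qed.

Lemma quot_basis_free (R : nzRingType) (V : lmodType R) (L N : set V) n
    (w : 'I_n -> V) (v : V) (a : 'rV[R]_n) :
  (forall u v, N u -> N v -> N (u - v)) ->
  is_quot_basis L N w -> L v -> N (\sum_i a 0 i *: w i) -> a = 0.
Proof.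
move=> NB [_ ex] /ex[c [Nc cuniq]] Na.
apply: (addrI c); rewrite addr0; symmetry; apply: cuniq.
have -> : v - \sum_i (c + a) 0 i *: w i =
    (v - \sum_i c 0 i *: w i) - \sum_i a 0 i *: w i.
  under eq_bigr do rewrite mxE scalerDl.
  by rewrite big_split opprD addrA.
exact: NB.
Qed.

(** The matrices P and Q that express two bases in each other are inverse to
    each other, so that n = n' and the determinants of P and Q are 1 or -1. *)
Lemma basis_gram_unique (L : set {mpoly int[3]}) n n'
    (w : 'I_n -> {mpoly int[3]}) (w' : 'I_n' -> {mpoly int[3]}) :
  is_quot_basis L [set 0] w -> is_quot_basis L [set 0] w' ->
  \det (gram w) = \det (gram w').
Proof.
have change m k (u : 'I_m -> {mpoly int[3]}) (v : 'I_k -> {mpoly int[3]}) :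
    is_quot_basis L [set 0] u -> is_quot_basis L [set 0] v ->
    exists P : 'M_(k, m), forall i, v i = \sum_j P i j *: u j.
  move=> [_ exu] [Lv _].
  have /choice[r rP] i : exists a : 'rV_m, v i = \sum_j a 0 j *: u j.
    have [a [/eqP]] := exu _ (Lv i).
    by rewrite subr_eq0 => /eqP; exists a.
  exists (\matrix_i r i) => i; rewrite {1}rP.
  by apply: eq_bigr => j _; rewrite mxE.
have inv m k (u : 'I_m -> {mpoly int[3]}) (v : 'I_k -> {mpoly int[3]})
    (P : 'M_(k, m)) (Q : 'M_(m, k)) : is_quot_basis L [set 0] u ->
    (forall i, v i = \sum_j P i j *: u j) ->
    (forall i, u i = \sum_j Q i j *: v j) -> Q *m P = 1%:M.
  move=> ubas vP uQ; apply/row_matrixP=> i; apply/eqP; rewrite -subr_eq0.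
  case: (ubas) => Lu _; apply/eqP.
  apply: (quot_basis_free _ ubas (Lu i)); first by move=> _ _ -> ->; exact: subrr.
  rewrite /= -[RHS](subrr (u i)) {1}uQ.
  under eq_bigr do rewrite !mxE scalerBl.
  rewrite sumrB; congr (_ - _).
    under eq_bigr do rewrite scaler_suml.
    rewrite exchange_big; apply: eq_bigr => j _ /=; rewrite vP scaler_sumr.
    by apply: eq_bigr => l _; rewrite scalerA.
  rewrite (bigD1 i) //= big1 ?addr0 ?eqxx ?scale1r // => j ji.
  by rewrite eq_sym (negPf ji) scale0r.
move=> wbas w'bas.
have [P wP] := change _ _ _ _ wbas w'bas; have [Q w'Q] := change _ _ _ _ w'bas wbas.
have QP := inv _ _ _ _ _ _ wbas wP w'Q; have PQ := inv _ _ _ _ _ _ w'bas w'Q wP.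
have nn' : n = n' by apply/eqP; rewrite eqn_leq (mulmx1_min QP) (mulmx1_min PQ).
subst n'; have -> : gram w' = P *m gram w *m P^T.
  by rewrite -gram_base_change; apply/matrixP=> i j; rewrite !mxE !wP.
have /(congr1 determinant) := QP; rewrite det_mulmx det1 => dQP.
rewrite !det_mulmx det_tr mulrAC.
have -> : \det P * \det P = 1; last by rewrite mul1r.
have : (`|\det Q| * `|\det P|)%N = 1%N by rewrite -abszM dQP.
move/eqP; rewrite muln_eq1 => /andP[_ /eqP]; move: (\det P) => d d1.
by have [->|->] : d = 1 \/ d = -1 by lia.
Qed.

Lemma covolE (R : realType) (L : set {mpoly int[3]}) n (w : 'I_n -> {mpoly int[3]}) :
  is_quot_basis L [set 0] w -> covol R L = Num.sqrt (\det (gram w))%:~R.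
Proof.
move=> wbas; apply: xget_unique; first by exists n, w.
by move=> _ [n' [w' [w'bas ->]]]; rewrite (basis_gram_unique wbas w'bas).
Qed.

(** * The generic fibre *)

Local Notation QX := (@map_mpoly 3 _ _ (intr : int -> rat)).

Lemma clear_denominators (r : {mpoly rat[3]}) :
  exists (M : int) (r' : {mpoly int[3]}), M != 0 /\ M%:~R *: r = QX r'.
Proof.
elim/mpolyind: r => [|c m p _ _ [M [r' [M0 Mp]]]].
  by exists 1, 0; rewrite scaler0 raddf0.
exists (denq c * M), ((numq c * M) *: 'X_[m] + denq c *: r'); split.
  by rewrite mulf_neq0 // denq_neq0.
rewrite rmorphD /= !map_mpolyZ map_mpolyX /= -Mp scalerDr !scalerA !rmorphM /=.
congr (_ *: _ + _).
have <- : (denq c)%:~R * c = (numq c)%:~R.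
  by rewrite mulrC -[X in X * _](divq_num_den c) divfK // intr_eq0 denq_neq0.
by rewrite mulrAC.
Qed.

Lemma QX_inj : injective QX.
Proof.
move=> f g /mpolyP eq_fg; apply/mpolyP=> m; have := eq_fg m.
by rewrite !mcoeff_map_mpoly => /intr_inj.
Qed.

(** * Forms and charts *)

Lemma homogM (p q : {mpoly int[3]}) d e k :
  p \is d.-homog -> q \is e.-homog -> (d + e)%N = k -> p * q \is k.-homog.
Proof. by move=> homp homq <-; apply: dhomogM. Qed.

Lemma homogXn (i : 'I_3) n : 'X_i ^+ n \is [in int[3], n.-homog].
Proof.
have := @dhomogMn 3 int mdeg 1 'X_i n; rewrite mul1n; apply.
by rewrite dhomogX /= mdeg1.
Qed.

Section Charts.
Variable Z : chart_ideals int.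

Lemma fiber_ratP i f : is_ideal (Z i) -> fiber rat Z i f ->
  exists (N : int) (g : {mpoly int[3]}), [/\ N != 0, Z i g & N%:~R *: f = QX g].
Proof.
move=> [Z0 ZD ZM]; move: f; apply: (@smallest_sub _ _ _ [set f |
  exists (N : int) (g : {mpoly int[3]}), [/\ N != 0, Z i g & N%:~R *: f = QX g]]);
  last first.
  by move=> _ [g Zg <-]; exists 1, g; rewrite scale1r.
split; first by exists 1, 0; rewrite scaler0 raddf0.
  move=> f f' [N [g [N0 Zg Nf]]] [N' [g' [N'0 Zg' Nf']]].
  exists (N * N'), (N'%:MP * g + N%:MP * g'); split; first exact: mulf_neq0.
    by apply: ZD; apply: ZM.
  rewrite rmorphD /= !rmorphM /= !map_mpolyC -Nf -Nf' !mul_mpolyC scalerDr !scalerA.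
  by congr (_ *: _ + _); rewrite mulrC.
move=> a f [N [g [N0 Zg Nf]]]; have [M [a' [M0 Ma]]] := clear_denominators a.
exists (M * N), (a' * g); split; [exact: mulf_neq0|exact: ZM|].
by rewrite [RHS]rmorphM /= -Ma -Nf -scalerAl -scalerAr scalerA -rmorphM.
Qed.

Hypothesis cZ : is_closed_subscheme Z.
Hypothesis fZ : is_flat Z.

Lemma chart_ideal c : is_ideal (Z c). Proof. by case: cZ. Qed.

Lemma chart_comb c a f b g : Z c f -> Z c g -> Z c (a * f + b * g).
Proof. by case: (chart_ideal c) => _ ZD ZM Zf Zg; apply: ZD; apply: ZM. Qed.

Lemma chart_mul c a f : Z c f -> Z c (a * f).
Proof. by case: (chart_ideal c) => _ _; apply. Qed.

Lemma chart_flat c (N : int) f : N != 0 -> Z c (N%:MP * f) -> Z c f.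
Proof. by move=> N0; rewrite mul_mpolyC; apply: fZ. Qed.

Lemma chart_X1 c n : Z c ('X_c ^+ n - 1).
Proof. by rewrite subrX1 mulrC; apply: chart_mul; case: cZ. Qed.

Lemma chart_Xn c n f : Z c ('X_c ^+ n * f) -> Z c f.
Proof.
move=> ZXf; have -> : f = 1 * ('X_c ^+ n * f) + (- f) * ('X_c ^+ n - 1) by ring.
exact: chart_comb (chart_X1 _ _).
Qed.

(** This is [dim0_power_stable] on the generic fibre, with denominators cleared. *)
Lemma chart_power_stable i h : has_dim0 (fiber rat Z) ->
  exists (n : nat) (N : int) r, N != 0 /\ Z i (h ^+ n * (N%:MP - h * r)).
Proof.
move=> dim0; have idZ := chart_ideal i.
have idF : is_ideal (fiber rat Z i).
  split.
  - by move=> A [[A0 _ _] _].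
  - by move=> f g Ff Fg A AA; case: (AA) => -[_ AD _] _; apply: AD; [apply: Ff|apply: Fg].
  - by move=> a f Ff A AA; case: (AA) => -[_ _ AM] _; apply: AM; apply: Ff.
have [n [r Fr]] := dim0_power_stable (QX h) idF (dim0 i).
have [N [g [N0 Zg Ng]]] := fiber_ratP idZ Fr.
have [M [r' [M0 Mr]]] := clear_denominators r.
exists n, (N * M), (N%:MP * r'); split; first exact: mulf_neq0.
suff -> : h ^+ n * ((N * M)%:MP - h * (N%:MP * r')) = M%:MP * g by exact: chart_mul.
apply: QX_inj.
rewrite [RHS]rmorphM /= -Ng !(rmorphM, rmorphB, rmorphXn) /= !map_mpolyC -Mr.
have rearrange (A : comNzRingType) (H a b s : A) :
  H ^+ n * (a * b - H * (a * (b * s))) = b * (a * (H ^+ n * (1 - H * s))) by ring.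
by rewrite -!mul_mpolyC /= rearrange.
Qed.

(** The gluing condition for the charts i and c gives an exponent for each c. *)
Lemma spread_vanishing d F i : F \is d.-homog -> Z i F ->
  exists n, forall c, Z c ('X_i ^+ n * F).
Proof.
move=> homF ZF; case: cZ => _ _ glue.
have /choice[n nP] c : exists n, Z c ('X_i ^+ n * F).
  have [van _] := glue i c d F homF.
  by apply: van; exists 0%N; rewrite expr0 mul1r.
exists (\sum_c n c)%N => c.
by rewrite (bigD1 c) //= addnC exprD -mulrA; apply: chart_mul.
Qed.

Lemma homogenize i (r : {mpoly int[3]}) :
  exists (k : nat) G, G \is k.-homog /\ Z i (r - G).
Proof.
pose k := msize r; pose p d := pihomog mdeg d r.
exists k, (\sum_(d < k) 'X_i ^+ (k - d) * p d); split.
  apply: rpred_sum => d _; apply: homogM (homogXn _ _) (pihomogP _ _ _) _.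
  by rewrite subnK // ltnW.
rewrite {1}[r](@pihomog_partitionE _ _ mdeg k) // -sumrB.
case: (chart_ideal i) => Z0 ZD _.
elim/big_ind: _ => // d _.
have -> : pihomog mdeg d r - 'X_i ^+ (k - d) * p d = - p d * ('X_i ^+ (k - d) - 1).
  by rewrite mulNr mulrBr mulr1 opprB mulrC.
exact/chart_mul/chart_X1.
Qed.

(** The condition exhibits N^-1 G_i / X_i^(m+1) as an inverse of h on the part of
    Z on which h does not vanish; on the complementary part, h^n is zero. *)
Definition stable_data h n (N : int) m (G : 'I_3 -> {mpoly int[3]}) :=
  [/\ N != 0, forall i, G i \is m.-homog &
    forall i c, Z c (N%:MP * 'X_i ^+ m.+1 * h ^+ n - h ^+ n.+1 * G i)].

(** On each chart the remainder r of [chart_power_stable] is replaced by a form,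
    and the resulting relation is spread over all charts; a common n, N and m
    for the three charts is reached by multiplying with powers of h and X_i. *)
Lemma stable_data_exists h : has_dim0 (fiber rat Z) -> h \is 1.-homog ->
  exists n N m G, stable_data h n N m G.
Proof.
move=> dim0 homh.
have one i : exists d : nat * int * nat * {mpoly int[3]},
    [/\ d.1.1.2 != 0, d.2 \is d.1.2.-homog & forall c,
      Z c (d.1.1.2%:MP * 'X_i ^+ d.1.2.+1 * h ^+ d.1.1.1 - h ^+ d.1.1.1.+1 * d.2)].
  have [n [N [r [N0 Zr]]]] := chart_power_stable i h dim0.
  have [k [G [homG rG]]] := homogenize i r.
  have [||e eP] := @spread_vanishing (n + k.+1) (h ^+ n * (N%:MP * 'X_i ^+ k.+1 - h * G)) i.
  - apply: dhomogM; first by rewrite -[n in n.-homog]mul1n dhomogMn.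
    apply: rpredB; first by rewrite mul_mpolyC rpredZ // homogXn.
    exact: homogM homh homG _.
  - have rearrange (A : comNzRingType) (x H a s g X : A) : x * (a * X - H * g) =
      1 * (x * (a - H * s)) + 1 * ((x * a) * (X - 1) + (x * H) * (s - g)) by ring.
    rewrite (rearrange _ _ _ _ r); apply: chart_comb => //.
    exact/chart_comb/rG/chart_X1.
  exists (n, N, (e + k)%N, 'X_i ^+ e * G); split=> //=.
    exact: homogM (homogXn _ _) homG _.
  move=> c; rewrite -addnS exprD [h ^+ n.+1]exprS.
  have rearrange (A : comNzRingType) (x H a g X Y : A) :
    a * (X * Y) * x - H * x * (X * g) = X * (x * (a * Y - H * g)) by ring.
  by rewrite rearrange.
have /choice[d dP] := one.
pose n := (\sum_i (d i).1.1.1)%N; pose m := (\sum_i (d i).1.2)%N.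
pose N := \prod_i (d i).1.1.2.
pose m' i := (m - (d i).1.2)%N; pose n' i := (n - (d i).1.1.1)%N.
pose N' i := \prod_(j | j != i) (d j).1.1.2.
exists n, N, m, (fun i => (N' i)%:MP * 'X_i ^+ m' i * (d i).2); split.
- by apply/prodf_neq0 => i _; have [] := dP i.
- move=> i; have [_ homd _] := dP i.
  apply: (@homogM _ _ (m' i) (d i).1.2) => //; first by rewrite mul_mpolyC rpredZ // homogXn.
  by rewrite subnK // /m (bigD1 i) //= leq_addr.
move=> i c; have [_ _ /(_ c)] := dP i.
have -> : N = N' i * (d i).1.1.2 by rewrite /N (bigD1 i) //= mulrC.
have -> : m.+1 = (m' i + (d i).1.2.+1)%N.
  by rewrite addnS subnK // /m (bigD1 i) //= leq_addr.
have -> : n = (n' i + (d i).1.1.1)%N by rewrite subnK // /n (bigD1 i) //= leq_addr.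
rewrite -addnS !exprD mpolyCM.
have rearrange (A : comNzRingType) (a b X Y x y z g : A) :
  a * b * (X * Y) * (x * y) - x * z * (a * X * g) = (a * X * x) * (b * Y * y - z * g).
  by ring.
by rewrite rearrange => ZG; apply: chart_mul.
Qed.

Section Fractions.
Variables (h : {mpoly int[3]}) (n : nat) (N : int) (m : nat) (G : 'I_3 -> {mpoly int[3]}).
Hypotheses (homh : h \is 1.-homog) (stab : stable_data h n N m G).

Lemma stable_data_pow e i c :
  Z c ((N ^+ e)%:MP * 'X_i ^+ (m.+1 * e) * h ^+ n - h ^+ (n + e) * G i ^+ e).
Proof.
have [_ _ Z1] := stab; elim: e => [|e IHe].
  by rewrite muln0 addn0 !expr0 mpolyC1 !mulr1 !mul1r subrr; case: (chart_ideal c).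
rewrite mulnS [N ^+ e.+1]exprS [G i ^+ e.+1]exprS mpolyCM exprD addnS [h ^+ (n + e).+1]exprS [h ^+ (n + e)]exprD.
have rearrange (A : comNzRingType) (a b X Y x z y g f : A) :
  a * b * (X * Y) * x - z * (x * y) * (g * f) =
  (a * X) * (b * Y * x - x * y * f) + (y * f) * (a * X * x - z * x * g) by ring.
rewrite rearrange; apply: chart_comb; first by rewrite -exprD.
by rewrite -exprS; apply: Z1.
Qed.

(** The section of O_Z that is N^(n+k) A / h^k where h is invertible, and
    zero on the rest of Z; here A is a form of degree k. *)
Definition fraction k (A : {mpoly int[3]}) : {ffun 'I_3 -> {mpoly int[3]}} :=
  [ffun i => A * h ^+ n * G i ^+ (n + k)].

(** Modulo Z, both sides of the equation to check on an overlap become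
    A h^(2 n + k) (G_i G_j)^(n + k) after multiplication by N^(n + k). *)
Lemma fraction_section k A : A \is k.-homog -> sections Z (fraction k A).
Proof.
move=> homA i j; have [N0 homG _] := stab.
have homF c : A * h ^+ n * G c ^+ (n + k) \is (m.+1 * (n + k)).-homog.
  apply: (@homogM _ _ (k + n) (m * (n + k))); last by rewrite mulSn addnC [(k + n)%N]addnC addnC.
    by apply: homogM homA _ _ => //; rewrite -[n in n.-homog]mul1n dhomogMn.
  exact: dhomogMn.
exists (m.+1 * (n + k))%N, (fraction k A i), (fraction k A j).
have Z00 c : Z c 0 by case: (chart_ideal c).
rewrite !subrr; split=> //; rewrite ?ffunE //.
exists 0%N; rewrite expr0 mul1r.
apply: (@chart_flat _ (N ^+ (n + k))); first by rewrite expf_neq0.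
have rearrange (B : comNzRingType) (a b x X Y z f g : B) :
  a * (X * (b * x * f) - Y * (b * x * g)) =
  (b * f) * (a * X * x - z * g) + (- (b * g)) * (a * Y * x - z * f) by ring.
by rewrite (rearrange _ _ _ _ _ _ (h ^+ (n + (n + k)))); apply/chart_comb/stable_data_pow/stable_data_pow.
Qed.

Lemma fraction_null k A c : Z c (fraction k A c) -> Z c (h ^+ n * A).
Proof.
rewrite ffunE => ZA; have [N0 _ _] := stab.
apply: (@chart_flat _ (N ^+ (n + k))); first by rewrite expf_neq0.
apply: (@chart_Xn _ (m.+1 * (n + k))).
have rearrange (B : comNzRingType) (a b x X y g : B) :
  X * (a * (x * b)) = b * (a * X * x - x * y * g) + y * (b * x * g) by ring.
rewrite (rearrange _ _ _ _ _ (h ^+ (n + k)) (G c ^+ (n + k))) -exprD.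
exact/chart_comb/ZA/stable_data_pow.
Qed.

End Fractions.

End Charts.

(** * Linear forms without zeros on Z *)

Section DegreeTwo.
Variable Z : chart_ideals int.
Hypotheses (cZ : is_closed_subscheme Z) (fZ : is_flat Z).
Variable w : 'I_2 -> {ffun 'I_3 -> {mpoly int[3]}}.
Hypothesis wbas : is_H0_basis Z w.

Definition vanishes (F : {mpoly int[3]}) := forall c, Z c F.

Lemma null_sectionsB s t :
  null_sections Z s -> null_sections Z t -> null_sections Z (s - t).
Proof. by move=> sN tN c; rewrite !ffunE; apply: ideal_sub (chart_ideal cZ c) _ _. Qed.

Lemma null_section0 : null_sections Z 0.
Proof. by move=> c; rewrite ffunE; case: (chart_ideal cZ c). Qed.

Lemma null_sectionsD s t :
  null_sections Z s -> null_sections Z t -> null_sections Z (s + t).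
Proof. by move=> sN tN c; rewrite !ffunE; case: (chart_ideal cZ c) => _ ZD _; apply: ZD. Qed.

Lemma null_sectionsZ (a : int) s : null_sections Z s -> null_sections Z (a *: s).
Proof. by move=> sN c; rewrite !ffunE -mul_mpolyC; apply: chart_mul. Qed.

Lemma null_sections_sum (I : finType) (s : I -> {ffun 'I_3 -> {mpoly int[3]}}) :
  (forall i, null_sections Z (s i)) -> null_sections Z (\sum_i s i).
Proof.
move=> sN; elim/big_ind: _ => //; [exact: null_section0|exact: null_sectionsD].
Qed.

Lemma basis_free (a : 'rV[int]_2) : null_sections Z (\sum_i a 0 i *: w i) -> a = 0.
Proof.
case: (wbas) => Lw _; apply: quot_basis_free (wbas) (Lw 0).
by move=> s t; apply: null_sectionsB.
Qed.

Lemma coordinates s : sections Z s ->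
  exists a : 'rV[int]_2, null_sections Z (s - \sum_i a 0 i *: w i).
Proof. by case: wbas => _ ex /ex[a [aP _]]; exists a. Qed.

Lemma three_sections_dependent s0 s1 s2 :
  sections Z s0 -> sections Z s1 -> sections Z s2 ->
  exists a b c : int, ~~ [&& a == 0, b == 0 & c == 0] /\
    forall x, Z x (a%:MP * s0 x + b%:MP * s1 x + c%:MP * s2 x).
Proof.
move=> sec0 sec1 sec2; pose s (i : 'I_3) := nth s0 [:: s0; s1; s2] i.
have /choice[u uP] (i : 'I_3) : exists a : 'rV[int]_2,
    null_sections Z (s i - \sum_k a 0 k *: w k).
  by apply: coordinates; case: i => -[|[|[|]]].
have [a a0 aU] := int_rows_dependent (\matrix_i u i).
exists (a 0 ord0), (a 0 (lift ord0 ord0)), (a 0 (lift ord0 (lift ord0 ord0))); split.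
  apply: contraNN a0 => /and3P[/eqP e0 /eqP e1 /eqP e2]; apply/eqP/rowP=> k.
  rewrite mxE; case: (unliftP ord0 k) => [{}k|] -> //.
  by case: (unliftP ord0 k) => [{}k|] -> //; rewrite ord1.
move=> x.
have : null_sections Z (\sum_i a 0 i *: (s i - \sum_k u i 0 k *: w k)).
  by apply: null_sections_sum => i; apply: null_sectionsZ.
under eq_bigr do rewrite scalerBr; rewrite sumrB.
have -> : \sum_i a 0 i *: (\sum_k u i 0 k *: w k) = 0.
  under eq_bigr do rewrite scaler_sumr; rewrite exchange_big big1 // => k _ /=.
  move/rowP/(_ k): aU; rewrite !mxE => aUk.
  rewrite -[RHS](scale0r (w k)) -aUk scaler_suml.
  by apply: eq_bigr => i _; rewrite !mxE scalerA.
rewrite subr0 => /(_ x); rewrite !big_ord_recl big_ord0 addr0 !ffunE addrA.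
by rewrite !mul_mpolyC.
Qed.

Lemma not_vanishes1 : exists i, ~ Z i 1.
Proof.
apply/existsNP => Z1; have /rowP/(_ 0)/eqP : (delta_mx 0 0 : 'rV[int]_2) = 0.
  apply: basis_free => c; rewrite -[X in Z c X]mulr1; exact: chart_mul.
by rewrite !mxE.
Qed.

(** h is a nonzerodivisor on the homogeneous coordinate ring of Z. *)
Definition regular_on (h : {mpoly int[3]}) :=
  forall d A, A \is d.-homog -> vanishes (h * A) -> vanishes A.

(** Choose a coordinate X_i that is not nilpotent on Z.  If it is a zero divisor,
    then, the rank being 2, Z consists over the rationals of two points: one where
    X_i is invertible, which carries the section e, and one where X_i is zero and
    some X_j is invertible, which carries the section f.  The forms X_i + X_j and
    X_i + 2 X_j are invertible at the second point, and at most one of them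
    vanishes at the first. *)
Lemma regular_form_exists : has_dim0 (fiber rat Z) ->
  exists2 h, h \is 1.-homog & regular_on h.
Proof.
move=> dim0; have [i Zi1] := not_vanishes1.
have homX j : 'X_j \is [in int[3], 1.-homog] by rewrite -[X in X \is _]expr1 homogXn.
have [|] := pselect (regular_on 'X_i); first by exists 'X_i.
move=> /existsNP[d /existsNP[A /not_implyP[homA /not_implyP[XA /existsNP[j ZjA]]]]].
have [ni [Ni [mi [Gi stabi]]]] := stable_data_exists cZ dim0 (homX i).
have [nj [Nj [mj [Gj stabj]]]] := stable_data_exists cZ dim0 (homX j).
pose e := fraction 'X_i ni Gi 0 1; pose f := fraction 'X_j nj Gj d A.
have sec_e : sections Z e by exact: (fraction_section cZ fZ (homX i) stabi (dhomog1 _ _)).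
have sec_f : sections Z f by exact: (fraction_section cZ fZ (homX j) stabj homA).
have ei0 : ~ Z i (e i).
  by move=> /(fraction_null cZ fZ stabi); apply: contra_not Zi1 => /(chart_Xn cZ).
have fj0 : ~ Z j (f j).
  by move=> /(fraction_null cZ fZ stabj); apply: contra_not ZjA => /(chart_Xn cZ).
have Xf c : Z c ('X_i * f c).
  by rewrite ffunE -!mulrA mulrA [_ * (_ * Gj c ^+ _)]mulrC; apply: chart_mul.
have fi0 : Z i (f i) by apply: (@chart_Xn _ cZ i 1); rewrite expr1.
pose h t := 'X_i + t%:MP * 'X_j : {mpoly int[3]}.
have homh t : h t \is 1.-homog by rewrite rpredD // mul_mpolyC rpredZ.
have bad t : t != 0 -> ~ regular_on (h t) -> Z i ((1 + t%:MP * 'X_j) * e i).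
  move=> t0 /existsNP[k /existsNP[B /not_implyP[homB /not_implyP[hB /existsNP[c ZcB]]]]].
  have [n [N [m [G stab]]]] := stable_data_exists cZ dim0 (homX c).
  pose g := fraction 'X_c n G k B.
  have sec_g : sections Z g by exact: (fraction_section cZ fZ (homX c) stab homB).
  have gc0 : ~ Z c (g c).
    by move=> /(fraction_null cZ fZ stab); apply: contra_not ZcB => /(chart_Xn cZ).
  have hg x : Z x (h t * g x).
    by rewrite ffunE -!mulrA mulrA [_ * (_ * G x ^+ _)]mulrC; apply: chart_mul.
  have [a [b [c' [abc dep]]]] := three_sections_dependent sec_e sec_f sec_g.
  have hdep x : Z x (a%:MP * (h t * e x) + b%:MP * (h t * f x)).
    have -> : a%:MP * (h t * e x) + b%:MP * (h t * f x) = h t *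
        (a%:MP * e x + b%:MP * f x + c'%:MP * g x) + (- c'%:MP) * (h t * g x).
      by move: (e x) (f x) (g x) (h t) => ex fx gx ht; ring.
    exact: chart_comb.
  have [a_0|a_neq0] := eqVneq a 0; last first.
    have -> : (1 + t%:MP * 'X_j) * e i = 1 * (h t * e i) + (- e i) * ('X_i ^+ 1 - 1).
      by rewrite /h; move: (e i) 'X_i 'X_j => x y z; ring.
    apply: (chart_comb cZ) (chart_X1 cZ _ _); apply: (chart_flat fZ a_neq0).
    rewrite -[X in Z i X](addrK (b%:MP * (h t * f i))).
    have -> : forall u, u - b%:MP * (h t * f i) = 1 * u + (- (b%:MP * h t)) * f i.
      by move=> u; move: (f i) (h t) => x y; ring.
    exact: chart_comb.
  have b_0 : b = 0.
    apply/eqP/negPn/negP => b0; apply: fj0; apply: (chart_flat fZ b0).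
    apply: (chart_flat fZ t0); apply: (@chart_Xn _ cZ j 1).
    have -> : 'X_j ^+ 1 * (t%:MP * (b%:MP * f j)) =
        1 * (a%:MP * (h t * e j) + b%:MP * (h t * f j)) + (- b%:MP) * ('X_i * f j).
      by rewrite a_0 /h; move: (e j) (f j) 'X_i 'X_j => x x' y z; ring.
    exact: chart_comb.
  exfalso; apply: gc0; move: abc; rewrite a_0 b_0 !eqxx /= => c0.
  apply: (chart_flat fZ c0); have := dep c; rewrite a_0 b_0.
  by rewrite !mul_mpolyC !scale0r !add0r.
have [r1|nr1] := pselect (regular_on (h 1)); first by exists (h 1).
have [r2|nr2] := pselect (regular_on (h 2)); first by exists (h 2).
exfalso; apply: ei0.
have -> : e i = 2 * ((1 + 1%:MP * 'X_j) * e i) + (- 1) * ((1 + 2%:MP * 'X_j) * e i).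
  by move: (e i) => x; move: 'X_j => y; ring.
by apply: (chart_comb cZ); apply: bad.
Qed.

End DegreeTwo.

(** * Linear and quadratic forms in three variables *)

Lemma mnm2_eq (i j k l : 'I_3) :
  (U_(i) + U_(j) == U_(k) + U_(l))%MM = ((i == k) && (j == l)) || ((i == l) && (j == k)).
Proof.
apply/eqP/orP => [E|[/andP[/eqP-> /eqP->]|/andP[/eqP-> /eqP->]]] //; last exact: addmC.
have U1 (a b : 'I_3) : U_(a)%MM = U_(b)%MM -> a = b.
  by move/mnmP/(_ a); rewrite !mnm1E eqxx; case: eqVneq.
have /mnmP/(_ i) := E; rewrite !mnmDE !mnm1E eqxx.
have [ki _|_] := eqVneq k i.
  by left; subst k; apply/eqP/U1/(@addmI _ U_(i)%MM).
have [li _|_] := eqVneq l i; last by [].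
by right; subst l; apply/eqP/U1/(@addmI _ U_(i)%MM); rewrite E addmC.
Qed.

Lemma mnm_mdeg2 (m : 'X_{1..3}) : mdeg m = 2%N -> exists i j, m = (U_(i) + U_(j))%MM.
Proof.
move=> m2; have [i mi] : exists i, (0 < m i)%N.
  have [i mi|m0] := pickP (fun i => 0 < m i)%N; first by exists i.
  move: m2; rewrite mdegE big1 // => i _; apply/eqP; by rewrite -leqn0 leqNgt m0.
have le_im : (U_(i) <= m)%MM by rewrite lep1mP -lt0n.
have /eqP/mdeg1P[j /eqP mj] : mdeg (m - U_(i))%MM = 1%N.
  by have := mdegD (m - U_(i))%MM U_(i); rewrite submK // m2 mdeg1 addn1 => -[].
by exists i, j; rewrite -mj addmC submK.
Qed.

Lemma mem_three (i j k a : 'I_3) : uniq [:: i; j; k] -> [|| a == i, a == j | a == k].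
Proof. by move: i j k a; do 4!case=> [[|[|[|?]]] ?]. Qed.

Lemma sum_three (V : nmodType) (i j k : 'I_3) (f : 'I_3 -> V) :
  uniq [:: i; j; k] -> \sum_a f a = f i + f j + f k.
Proof.
move=> uijk; have [] := andP uijk; rewrite !inE negb_or => /andP[ij ik] /andP[jk _].
rewrite (bigD1 i) // (bigD1 j) 1?eq_sym // (bigD1 k) /=; last by rewrite eq_sym ik eq_sym.
rewrite big1 ?addr0 ?addrA // => a /andP[/andP[ai aj] ak].
by have := mem_three a uijk; rewrite (negPf ai) (negPf aj) (negPf ak).
Qed.

Definition lin (l : 'I_3 -> int) : {mpoly int[3]} := \sum_k (l k)%:MP * 'X_k.

(** The quadratic form whose coefficient at X_i X_j is given by c i j; only the
    coefficients with i <= j in the order i, j, k of the indices are used. *)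
Definition quad (i j k : 'I_3) (c : 'I_3 -> 'I_3 -> int) : {mpoly int[3]} :=
  (c i i)%:MP * 'X_i ^+ 2 + (c j j)%:MP * 'X_j ^+ 2 + (c k k)%:MP * 'X_k ^+ 2
  + (c i j)%:MP * ('X_i * 'X_j) + (c i k)%:MP * ('X_i * 'X_k)
  + (c j k)%:MP * ('X_j * 'X_k).

Definition lcoef (F : {mpoly int[3]}) (k : 'I_3) : int := F@_(U_(k)).
Definition qcoef (F : {mpoly int[3]}) (i j : 'I_3) : int := F@_(U_(i) + U_(j)).

Lemma homogX1 (i : 'I_3) : 'X_i \is [in int[3], 1.-homog].
Proof. by have := homogXn i 1; rewrite expr1. Qed.

Lemma homogCM d (c : int) (F : {mpoly int[3]}) : F \is d.-homog -> c%:MP * F \is d.-homog.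
Proof. by move=> homF; rewrite mul_mpolyC rpredZ. Qed.

Lemma lin_homog l : lin l \is 1.-homog.
Proof. by apply: rpred_sum => k _; apply/homogCM/homogX1. Qed.

Lemma quad_homog i j k c : quad i j k c \is 2.-homog.
Proof.
by rewrite !rpredD //; apply: homogCM; rewrite ?homogXn //;
   apply: (homogM (homogX1 _) (homogX1 _)).
Qed.

Lemma homog_eq d (F G : {mpoly int[3]}) : F \is d.-homog -> G \is d.-homog ->
  (forall m, mdeg m = d -> F@_m = G@_m) -> F = G.
Proof.
move=> homF homG FG; apply/mpolyP => m; have [/FG//|md] := eqVneq (mdeg m) d.
by rewrite (dhomog_nemf_coeff homF) ?(dhomog_nemf_coeff homG).
Qed.

Lemma lcoef_lin l k : lcoef (lin l) k = l k.
Proof.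
rewrite /lcoef raddf_sum /= (bigD1 k) //= mcoeffCM mcoeffX eqxx mulr1.
rewrite big1 ?addr0 // => i ik; rewrite mcoeffCM mcoeffX.
suff /negPf-> : U_(i)%MM != U_(k)%MM by rewrite mulr0.
by apply: contraNneq ik => /mnmP/(_ k); rewrite !mnm1E eqxx; case: eqVneq.
Qed.

Lemma homog1E (F : {mpoly int[3]}) : F \is 1.-homog -> F = lin (lcoef F).
Proof.
move=> homF; apply: (homog_eq homF (lin_homog _)) => m /eqP/mdeg1P[k /eqP->].
by rewrite -/(lcoef (lin _) k) lcoef_lin.
Qed.

Lemma qcoefC F i j : qcoef F i j = qcoef F j i.
Proof. by rewrite /qcoef addmC. Qed.

Lemma qcoefXX (a b i j : 'I_3) :
  qcoef ('X_a * 'X_b) i j = (((a == i) && (b == j)) || ((a == j) && (b == i)))%:R.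
Proof. by rewrite /qcoef -mpolyXD mcoeffX mnm2_eq. Qed.

Lemma qcoefD F G i j : qcoef (F + G) i j = qcoef F i j + qcoef G i j.
Proof. exact: mcoeffD. Qed.

Lemma qcoefCM c F i j : qcoef (c%:MP * F) i j = c * qcoef F i j.
Proof. exact: mcoeffCM. Qed.

Lemma homog2E (F : {mpoly int[3]}) i j k : uniq [:: i; j; k] -> F \is 2.-homog ->
  F = quad i j k (qcoef F).
Proof.
move=> uijk homF; apply: (homog_eq homF (quad_homog _ _ _ _)) => m /mnm_mdeg2[a [b ->]].
rewrite -!/(qcoef _ a b) /quad !expr2 !qcoefD !qcoefCM !qcoefXX.
have [] := andP uijk; rewrite !inE negb_or => /andP[ij ik] /andP[jk _].
have [ji [ki kj]] : j != i /\ k != i /\ k != j by rewrite ![_ == i]eq_sym [k == j]eq_sym.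
have := qcoefC F; move: (qcoef F) => q qC.
have := mem_three a uijk; have := mem_three b uijk.
by case/or3P=> /eqP->; case/or3P=> /eqP->;
  rewrite !eqxx ?(negPf ij) ?(negPf ik) ?(negPf jk) ?(negPf ji) ?(negPf ki) ?(negPf kj)
    /= !mulr0 !mulr1 ?addr0 ?add0r // qC.
Qed.

Lemma qcoef_linX l a i j : qcoef (lin l * 'X_a) i j =
  (j == a)%:R * l i + ((i == a) && (i != j))%:R * l j.
Proof.
rewrite /lin mulr_suml /qcoef raddf_sum /=.
transitivity (\sum_k (l k) * (((k == i) && (a == j)) || ((k == j) && (a == i)))%:R).
  by apply: eq_bigr => k _; rewrite -mulrA mcoeffCM -/(qcoef _ _ _) qcoefXX.
rewrite (bigD1 i) //= eqxx /= [j == a]eq_sym [i == a]eq_sym.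
have [<-|ij] := eqVneq i j.
  rewrite andbF mul0r addr0 orbb mulrC big1 ?addr0 // => k ki.
  by rewrite (negPf ki) mulr0.
rewrite /= orbF mulrC andbT; congr (_ + _).
have ji : j != i by rewrite eq_sym.
rewrite (bigD1 j) //= eqxx (negPf ji) /= mulrC.
rewrite big1 ?addr0 // => k /andP[ki kj].
by rewrite (negPf ki) (negPf kj) mulr0.
Qed.

Lemma qcoef_lin_mul l m i j :
  qcoef (lin l * lin m) i j = l i * m j + (i != j)%:R * (l j * m i).
Proof.
rewrite {2}/lin mulr_sumr /qcoef raddf_sum /=.
transitivity (\sum_a m a * ((j == a)%:R * l i + ((i == a) && (i != j))%:R * l j)).
  by apply: eq_bigr => a _; rewrite mulrCA mcoeffCM -/(qcoef _ _ _) qcoef_linX.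
under eq_bigr do rewrite mulrDr; rewrite big_split /=; congr (_ + _).
  rewrite (bigD1 j) //= eqxx mul1r mulrC big1 ?addr0 // => a.
  by rewrite eq_sym => /negPf->; rewrite mul0r mulr0.
rewrite (bigD1 i) //= eqxx /= mulrCA [m i * _]mulrC big1 ?addr0 // => a.
by rewrite eq_sym => /negPf->; rewrite mul0r mulr0.
Qed.

(** * Quadratic forms modulo a linear form *)

Section Reduction.
Variables (i j k : 'I_3) (l : 'I_3 -> int).
Hypothesis uijk : uniq [:: i; j; k].

(** The coefficients of X_i^2, X_i X_j and X_j^2 in the form obtained from
    l_k^2 F by eliminating X_k with the relation lin l = 0. *)
Definition red F : 'rV[int]_3 :=
  let q := qcoef F in
  \row_t [:: q i i * l k ^+ 2 - q i k * l i * l k + q k k * l i ^+ 2;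
   q i j * l k ^+ 2 - q i k * l j * l k - q j k * l i * l k + 2 * q k k * l i * l j;
   q j j * l k ^+ 2 - q j k * l j * l k + q k k * l j ^+ 2]`_t.

Lemma redD F G : red (F + G) = red F + red G.
Proof.
by apply/rowP; case=> -[|[|[|//]]] lt_t3; rewrite !mxE /= !qcoefD;
   move: (qcoef F) (qcoef G) => f g; ring.
Qed.

Lemma redCM c F : red (c%:MP * F) = c *: red F.
Proof.
by apply/rowP; case=> -[|[|[|//]]] lt_t3; rewrite !mxE /= !qcoefCM;
   move: (qcoef F) => f; ring.
Qed.

Lemma redE F : F \is 2.-homog -> exists m, (l k ^+ 2)%:MP * F = lin l * lin m +
  ((red F 0 0)%:MP * 'X_i ^+ 2 + (red F 0 1)%:MP * ('X_i * 'X_j) + (red F 0 2)%:MP * 'X_j ^+ 2).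
Proof.
move=> homF; pose q := qcoef F.
exists (fun a => if a == k then q k k * l k else
  if a == i then q i k * l k - q k k * l i else q j k * l k - q k k * l j).
have [] := andP uijk; rewrite !inE negb_or => /andP[ij ik] /andP[jk _].
rewrite /lin !(sum_three _ uijk) !eqxx (negPf ik) (negPf jk).
rewrite [j == i]eq_sym (negPf ij).
rewrite {1}(homog2E uijk homF) /quad /red !mxE /=; rewrite -/q.
move: (q i i) (q j j) (q k k) (q i j) (q i k) (q j k) (l i) (l j) (l k) => a b c d e f u v w.
have rearrange (x y z : {mpoly int[3]}) : (w ^+ 2)%:MP *
   (a%:MP * x ^+ 2 + b%:MP * y ^+ 2 + c%:MP * z ^+ 2 + d%:MP * (x * y) + e%:MP * (x * z)
    + f%:MP * (y * z)) =
   (u%:MP * x + v%:MP * y + w%:MP * z) *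
   ((e * w - c * u)%:MP * x + (f * w - c * v)%:MP * y + (c * w)%:MP * z) +
   ((a * w ^+ 2 - e * u * w + c * u ^+ 2)%:MP * x ^+ 2 +
    (d * w ^+ 2 - e * v * w - f * u * w + 2 * c * u * v)%:MP * (x * y) +
    (b * w ^+ 2 - f * v * w + c * v ^+ 2)%:MP * y ^+ 2) by ring.
exact: rearrange.
Qed.

Lemma red_lin_mul m : red (lin l * lin m) = 0.
Proof.
have [] := andP uijk; rewrite !inE negb_or => /andP[ij ik] /andP[jk _].
apply/rowP; case=> -[|[|[|//]]] lt_t3;
  by rewrite !mxE /= !qcoef_lin_mul !eqxx ?ij ?ik ?jk /=; ring.
Qed.

End Reduction.

(** Gauss's lemma for linear forms: a prime divisor p of N that does not divide
    l_a divides m_a and then all the other m_b, as is seen on the coefficients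
    of X_a^2 and X_a X_b of the product. *)
Lemma gauss_linear l m (N : int) v :
  (forall p, prime p -> exists a, ~~ (p %| l a)%Z) -> N != 0 ->
  N%:MP * v = lin l * lin m -> exists m', v = lin l * lin m'.
Proof.
move=> lprim; have [n] := ubnP `|N|%N; elim: n N m => // n IHn N m leNn N0 Nv.
have [N1|N1] := eqVneq `|N|%N 1%N.
  exists (fun a => N * m a).
  have -> : lin (fun a => N * m a) = N%:MP * lin m.
    by rewrite /lin mulr_sumr; apply: eq_bigr => a _; rewrite mpolyCM mulrA.
  rewrite mulrCA -Nv mulrA -mpolyCM.
  have -> : N * N = 1 by have [->|->] : N = 1 \/ N = -1 by lia.
  by rewrite mpolyC1 mul1r.
have p_pr : prime (pdiv `|N|) by rewrite pdiv_prime //; lia.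
set p := pdiv _ in p_pr.
have pN : (p %| N)%Z by rewrite dvdzE pdiv_dvd.
have [a pla] := lprim p p_pr.
have coefE b c : l b * m c + (b != c)%:R * (l c * m b) = N * qcoef v b c.
  by rewrite -qcoef_lin_mul -Nv qcoefCM.
have Euclid x y : (p %| x * y)%Z -> ~~ (p %| x)%Z -> (p %| y)%Z.
  by rewrite !dvdzE /= abszM Euclid_dvdM // => /orP[->|].
have pma : (p %| m a)%Z.
  apply: Euclid pla; have := coefE a a; rewrite eqxx mul0r addr0 => ->.
  exact: dvdz_mulr.
have pm b : (p %| m b)%Z.
  have [->//|ba] := eqVneq b a; apply: Euclid pla.
  have := coefE a b; rewrite eq_sym ba mul1r => /(canRL (addrK _))->.
  by apply: rpredB; [apply: dvdz_mulr|apply: dvdz_mull].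
have p0 : p%:Z != 0 by have := prime_gt0 p_pr; lia.
have p0' : p%:Z%:MP_[3] != 0 by rewrite mpolyC_eq0.
case/dvdzP: pN => N' NE.
have mE : lin m = p%:Z%:MP * lin (fun b => m b %/ p)%Z.
  rewrite /lin mulr_sumr; apply: eq_bigr => b _.
  by rewrite mulrA -mpolyCM [p%:Z * _]mulrC divzK.
apply: (IHn N' (fun b => m b %/ p)%Z).
- have := prime_gt1 p_pr; rewrite NE abszM /= in leNn N0 *; nia.
- by apply: contraNneq N0 => N'0; rewrite NE N'0 mul0r.
apply: (mulfI p0'); rewrite mulrA -mpolyCM [_ * N']mulrC -NE Nv mE.
by rewrite mulrCA.
Qed.

(** * Forms of degree one and two that vanish on Z *)

Section VanishingForms.
Variable Z : chart_ideals int.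
Hypotheses (cZ : is_closed_subscheme Z) (fZ : is_flat Z) (dim0 : has_dim0 (fiber rat Z)).
Variable w : 'I_2 -> {ffun 'I_3 -> {mpoly int[3]}}.
Hypothesis wbas : is_H0_basis Z w.

Lemma vanishes_comb a F b G : vanishes Z F -> vanishes Z G -> vanishes Z (a * F + b * G).
Proof. by move=> ZF ZG c; apply: chart_comb. Qed.

Lemma vanishes_mul a F : vanishes Z F -> vanishes Z (a * F).
Proof. by move=> ZF c; apply: chart_mul. Qed.

Lemma vanishes_flat (N : int) F : N != 0 -> vanishes Z (N%:MP * F) -> vanishes Z F.
Proof. by move=> N0 ZF c; apply: (chart_flat fZ N0). Qed.

(** Dividing by the k-th power of a regular linear form embeds the forms of
    degree k modulo those vanishing on Z into H^0(Z, O_Z), whose rank is 2. *)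
Lemma three_forms_dependent k A0 A1 A2 :
  A0 \is k.-homog -> A1 \is k.-homog -> A2 \is k.-homog ->
  exists a b c : int, ~~ [&& a == 0, b == 0 & c == 0] /\
    vanishes Z (a%:MP * A0 + b%:MP * A1 + c%:MP * A2).
Proof.
move=> hom0 hom1 hom2; have [h homh regh] := regular_form_exists cZ fZ wbas dim0.
have [n [N [m [G stab]]]] := stable_data_exists cZ dim0 homh.
have sec A : A \is k.-homog -> sections Z (fraction h n G k A).
  exact: (fraction_section cZ fZ homh stab).
have [a [b [c [abc dep]]]] :=
  three_sections_dependent cZ wbas (sec _ hom0) (sec _ hom1) (sec _ hom2).
exists a, b, c; split=> //; set A := _ + _ + _.
have homA : A \is k.-homog by rewrite !rpredD ?homogCM.
have : vanishes Z (h ^+ n * A).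
  move=> x; apply: (fraction_null cZ fZ stab (k := k)); have := dep x; rewrite !ffunE /A.
  have rearrange (B : comNzRingType) (r s t u v z y g : B) : (r * u + s * v + t * z) * y * g
    = r * (u * y * g) + s * (v * y * g) + t * (z * y * g) by ring.
  by rewrite rearrange.
elim: n {stab sec dep} => [|n IHn]; first by rewrite expr0 mul1r.
rewrite exprS -mulrA => /(regh (n + k)%N) hA; apply: IHn; apply: hA.
apply: dhomogM homA; by rewrite -[n in n.-homog]mul1n; apply: dhomogMn.
Qed.

(** If all coordinates are proportional on Z, then Z is a single reduced point
    and all sections are constant, so that H^0(Z, O_Z) has rank at most 1. *)
Lemma coordinates_not_proportional (p : 'I_3 -> int) b : p b != 0 ->
  ~ forall a, vanishes Z ((p b)%:MP * 'X_a - (p a)%:MP * 'X_b).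
Proof.
move=> pb0 prop.
pose const a F := exists (N c : int), N != 0 /\ Z a (N%:MP * F - c%:MP).
have constb F : const b F.
  have constM G H : const b G -> const b H -> const b (G * H).
    move=> [N [c [N0 ZG]]] [N' [c' [N'0 ZH]]].
    exists (N * N'), (c * c'); split; first exact: mulf_neq0.
    have -> : (N * N')%:MP * (G * H) - (c * c')%:MP =
      (N'%:MP * H) * (N%:MP * G - c%:MP) + c%:MP * (N'%:MP * H - c'%:MP) by ring.
    exact: chart_comb.
  have const1 : const b 1.
    by exists 1, 1; rewrite mulr1 subrr; split=> //; case: (chart_ideal cZ b).
  have constX i : const b 'X_i.
    exists (p b), (p i); split=> //.
    have -> : (p b)%:MP * 'X_i - (p i)%:MP =
      1 * ((p b)%:MP * 'X_i - (p i)%:MP * 'X_b) + (p i)%:MP * ('X_b ^+ 1 - 1).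
      by move: 'X_i 'X_b => x y; ring.
    by apply: (chart_comb cZ); [exact: prop|exact: chart_X1].
  elim/mpolyind: F => [|c m G _ _ [N [c' [N0 ZG]]]].
    by exists 1, 0; rewrite mulr0 subrr; split=> //; case: (chart_ideal cZ b).
  have [M [d [M0 ZX]]] : const b 'X_[m].
    rewrite mpolyXE_id; elim/big_ind: _ => // i _.
    by elim: (m i) => [|e IHe]; rewrite ?expr0 // exprS; apply: constM.
  exists (N * M), (c * N * d + M * c'); split; first exact: mulf_neq0.
  rewrite -mul_mpolyC.
  have -> : (N * M)%:MP * (c%:MP * 'X_[m] + G) - (c * N * d + M * c')%:MP =
    (c * N)%:MP * (M%:MP * 'X_[m] - d%:MP) + M%:MP * (N%:MP * G - c'%:MP).
    by move: 'X_[m] => x; ring.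
  exact: chart_comb.
have const_sec s : sections Z s -> exists (N c : int), N != 0 /\
    forall a, Z a (N%:MP * s a - c%:MP).
  move=> sec_s; have [N [c [N0 Zb]]] := constb (s b).
  exists N, c; split=> // a.
  have [d [F [G [homF homG ZF ZG [n Zn]]]]] := sec_s a b.
  have [||e Ze] := @spread_vanishing Z cZ d (N%:MP * G - c%:MP * 'X_b ^+ d) b.
  - by rewrite rpredB ?homogCM ?homogXn.
  - have -> : N%:MP * G - c%:MP * 'X_b ^+ d = 1 * (N%:MP * s b - c%:MP)
        + (- 1) * (N%:MP * (s b - G) + c%:MP * ('X_b ^+ d - 1)).
      by move: (s b) ('X_b ^+ d) => x y; ring.
    apply: (chart_comb cZ) => //; apply: (chart_comb cZ) => //; exact: chart_X1.
  set M := (n + e + d)%N.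
  have ZM : Z a ('X_b ^+ M * (N%:MP * s a - c%:MP)).
    have rearrange (A : comNzRingType) (q r x y f g u v z : A) :
      x * u * y * (q * z - r) = (x * u * y * q) * (z - f) + 1 * ((q * u) * (x * (y * f - v * g))
        + 1 * ((v * x) * (u * (q * g - r * y)) + (r * x * u * y) * (v - 1))) by ring.
    rewrite /M !exprD (rearrange _ _ _ _ _ F G _ ('X_a ^+ d)).
    apply: (chart_comb cZ) => //; apply: (chart_comb cZ).
      exact: Zn.
    by apply: (chart_comb cZ); [apply: Ze|apply: chart_X1].
  apply: (chart_flat fZ (N := p b ^+ M)); first by rewrite expf_neq0.
  have Zp : Z a ((p b)%:MP - (p a)%:MP * 'X_b).
    have -> : (p b)%:MP - (p a)%:MP * 'X_b = 1 * ((p b)%:MP * 'X_a - (p a)%:MP * 'X_b)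
      + (- (p b)%:MP) * ('X_a ^+ 1 - 1) by move: 'X_a 'X_b => x y; ring.
    by apply: (chart_comb cZ); [exact: prop|exact: chart_X1].
  have : Z a ((p b)%:MP ^+ M - ((p a)%:MP * 'X_b) ^+ M).
    by rewrite subrXX mulrC; apply: chart_mul.
  rewrite exprMn -!rmorphXn /= => ZpM.
  move: ZM ZpM; move: (N%:MP * _ - _) ('X_b ^+ M) ((p b ^+ M)%:MP) ((p a ^+ M)%:MP).
  move=> u x P P' Zu ZP.
  have -> : P * u = u * (P - P' * x) + P' * (x * u) by ring.
  exact: chart_comb.
case: (wbas) => secw _.
have [N0 [c0 [N00 Z0]]] := const_sec _ (secw 0).
have [N1 [c1 [N10 Z1]]] := const_sec _ (secw 1).
have free x y : (forall a, Z a (x%:MP * w 0 a + y%:MP * w 1 a)) -> x = 0 /\ y = 0.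
  move=> null; have /rowP a0 : \row_(i < 2) (if i == 0 then x else y) = 0.
    apply: (basis_free cZ wbas) => a; rewrite !big_ord_recl big_ord0 addr0 !ffunE !mxE /=.
    rewrite -!mul_mpolyC; have := null a; congr (Z a (_ + _ * w _ a)); exact: val_inj.
  by have := a0 0; have := a0 1; rewrite !mxE.
have [c1_0|c10] := eqVneq c1 0.
  have [|_ /eqP] := free 0 N1; last by rewrite (negPf N10).
  by move=> a; have := Z1 a; rewrite c1_0 subr0 mul0r add0r.
have [|/eqP] := free (c1 * N0) (- (c0 * N1)); last by rewrite mulf_eq0 (negPf c10) (negPf N00).
move=> a.
have -> : (c1 * N0)%:MP * w 0 a + (- (c0 * N1))%:MP * w 1 a =
  c1%:MP * (N0%:MP * w 0 a - c0%:MP) + (- c0%:MP) * (N1%:MP * w 1 a - c1%:MP).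
  by move: (w 0 a) (w 1 a) => x y; ring.
exact: chart_comb.
Qed.

Lemma linE i j k l : uniq [:: i; j; k] ->
  lin l = (l i)%:MP * 'X_i + (l j)%:MP * 'X_j + (l k)%:MP * 'X_k.
Proof. exact: sum_three. Qed.

Lemma third_index (i j : 'I_3) : i != j -> exists k, uniq [:: i; j; k].
Proof.
move=> ij; have [k /andP[ki kj]|none] := pickP (fun k => (k != i) && (k != j)).
  by exists k; rewrite /= !inE negb_or ij [i == k]eq_sym ki [j == k]eq_sym kj.
suff: (#|'I_3| <= #|pred2 i j|)%N by rewrite card_ord card2 ij.
apply/subset_leq_card/fintype.subsetP => k _; have := none k; rewrite !inE.
by case: (k == i); case: (k == j).
Qed.

(** Two lines through Z that are not proportional meet in the point given by the
    cross product p of l and m, and the relations p_k X_x = p_x X_k hold on Z. *)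
Lemma vanishing_linear_forms_parallel l m :
  vanishes Z (lin l) -> vanishes Z (lin m) -> forall a b, l a * m b = l b * m a.
Proof.
move=> Zl Zm a b; apply/eqP/negPn/negP => lm.
have ab : a != b by apply: contraNneq lm => ->.
have [k uabk] := third_index ab.
have [] := andP uabk; rewrite !inE negb_or => /andP[_ ak] /andP[bk _].
(* The cross product of l and m. *)
pose p x := if x == k then l a * m b - l b * m a else
  if x == a then l b * m k - l k * m b else l k * m a - l a * m k.
apply: (@coordinates_not_proportional p k); first by rewrite /p eqxx subr_eq0.
have comb u v : vanishes Z (u * lin l + v * lin m) by exact: vanishes_comb.
move=> x; case/or3P: (mem_three x uabk) => /eqP->; rewrite /p !eqxx.
- move: (comb (m b)%:MP (- (l b)%:MP)); rewrite !(linE _ uabk) (negPf ak).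
  congr (vanishes Z _); move: 'X_a 'X_b 'X_k => u v z; ring.
- move: (comb (- (m a)%:MP) (l a)%:MP); rewrite !(linE _ uabk) (negPf bk) [b == a]eq_sym (negPf ab).
  congr (vanishes Z _); move: 'X_a 'X_b 'X_k => u v z; ring.
- by rewrite subrr => c; case: (chart_ideal cZ c).
Qed.

(** The three coordinates are dependent in a module of rank 2, so some linear form
    vanishes on Z, and any two such forms are proportional.  One with the least
    nonzero k-th coefficient generates them all; it is primitive because Z is
    flat. *)
Lemma vanishing_linear_forms : exists l, [/\ vanishes Z (lin l), exists k, l k != 0,
  forall F, F \is 1.-homog -> vanishes Z F -> exists c : int, F = c%:MP * lin l
  & forall p : nat, prime p -> exists a, ~~ (p %| l a)%Z].
Proof.
have [a [b [c [abc Zabc]]]] := three_forms_dependent (homogX1 0) (homogX1 1) (homogX1 2).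
have u012 : uniq [:: 0; 1; 2 : 'I_3] by [].
pose l0 (x : 'I_3) := if x == 0 then a else if x == 1 then b else c.
have Zl0 : vanishes Z (lin l0) by rewrite (linE _ u012).
have [k lk0] : exists k, l0 k != 0.
  apply: contrapT => /forallNP l00; move/negP: abc; apply.
  by apply/and3P; split; apply/negPn/negP; [apply: (l00 0)|apply: (l00 1)|apply: (l00 2)].
have [||||g [[homg Zg] gk0 gen]] := @cyclic_mod_kernel _
    [set F | F \is 1.-homog /\ vanishes Z F] (lcoef ^~ k) (lin l0).
- by move=> u d v; rewrite /lcoef mcoeffB mcoeffZ.
- move=> u d v [homu Zu] [homv Zv]; split; first by rewrite rpredB ?rpredZ.
  by rewrite -mul_mpolyC -mulNr -[u]mul1r; apply: vanishes_comb.
- by split=> //; apply: lin_homog.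
- by rewrite lcoef_lin.
pose l := lcoef g; have gE : g = lin l by exact: homog1E.
have generates F : F \is 1.-homog -> vanishes Z F -> exists d : int, F = d%:MP * lin l.
  move=> homF ZF; have [d dP] := gen F (conj homF ZF).
  exists d; apply/eqP; rewrite -subr_eq0 -gE mul_mpolyC.
  have homG : F - d *: g \is 1.-homog by rewrite rpredB ?rpredZ.
  have ZG : vanishes Z (lin (lcoef (F - d *: g))).
    rewrite -homog1E // -mul_mpolyC -mulNr -[F]mul1r; exact: vanishes_comb.
  rewrite (homog1E homG) /lin big1 // => x _.
  have Zl : vanishes Z (lin l) by rewrite -gE.
  have := vanishing_linear_forms_parallel ZG Zl x k.
  rewrite dP mul0r => /eqP; rewrite mulf_eq0 (negPf gk0) orbF => /eqP->.
  by rewrite mul0r.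
exists l; split; [by rewrite -gE|by exists k|exact: generates|].
move=> p p_pr; apply: contrapT => /forallNP pl.
have p0 : p%:Z != 0 by have := prime_gt0 p_pr; lia.
pose l' x := (l x %/ p)%Z.
have lE : lin l = p%:Z%:MP * lin l'.
  rewrite /lin mulr_sumr; apply: eq_bigr => x _.
  by rewrite mulrA -mpolyCM [p%:Z * _]mulrC divzK //; apply/negPn/negP/pl.
have [d dE] : exists d : int, lin l' = d%:MP * lin l.
  apply: generates (lin_homog _) _; apply: (vanishes_flat p0).
  by rewrite -lE -gE.
have := lcoef_lin l' k; rewrite dE /lcoef mcoeffCM -/(lcoef _ _) lcoef_lin => dl'.
have := lcoef_lin l k; rewrite lE /lcoef mcoeffCM -/(lcoef _ _) lcoef_lin -dl'.
move=> pdl; have : p%:Z * d = 1 by apply: (mulIf gk0); rewrite mul1r -mulrA; exact: pdl.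
move/(congr1 absz)/eqP; rewrite abszM muln_eq1 => /andP[/eqP p1 _].
by have := prime_gt1 p_pr; rewrite -p1 ltnn.
Qed.
End VanishingForms.

Section VanishingConics.
Variable Z : chart_ideals int.
Hypotheses (cZ : is_closed_subscheme Z) (fZ : is_flat Z) (dim0 : has_dim0 (fiber rat Z)).
Variable w : 'I_2 -> {ffun 'I_3 -> {mpoly int[3]}}.
Hypothesis wbas : is_H0_basis Z w.
Variables (l : 'I_3 -> int) (i j k : 'I_3).
Hypotheses (Zl : vanishes Z (lin l)) (uijk : uniq [:: i; j; k]) (lk0 : l k != 0).

Lemma red0_vanishes F : F \is 2.-homog -> red i j k l F = 0 -> vanishes Z F.
Proof.
move=> homF redF; have [m] := redE l uijk homF.
rewrite redF !mxE mpolyC0 !mul0r !addr0 => FE.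
by apply: (vanishes_flat fZ (expf_neq0 2 lk0)); rewrite FE mulrC; apply: vanishes_mul.
Qed.

Lemma redXX a b c : red i j k l
    (a%:MP * ('X_i * 'X_i) + b%:MP * ('X_i * 'X_j) + c%:MP * ('X_j * 'X_j)) =
  (l k ^+ 2) *: (\row_t [:: a; b; c]`_t).
Proof.
have [] := andP uijk; rewrite !inE negb_or => /andP[ij ik] /andP[jk _].
have ji : j != i by rewrite eq_sym.
apply/rowP; case=> -[|[|[|//]]] lt_t3;
  rewrite !mxE /= !qcoefD !qcoefCM !qcoefXX !eqxx ?(negPf ij) ?(negPf ji) ?(negPf ik)
    ?(negPf jk) /=; ring.
Qed.

Lemma vanishing_binary_form : exists q, [/\ q \is 2.-homog, vanishes Z q & red i j k l q != 0].
Proof.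
have homXX (x y : 'I_3) : 'X_x * 'X_y \is [in int[3], 2.-homog].
  exact: homogM (homogX1 _) (homogX1 _) _.
have [a [b [c [abc Zq]]]] :=
  three_forms_dependent cZ fZ dim0 wbas (homXX i i) (homXX i j) (homXX j j).
eexists; split; [|exact: Zq|]; first by rewrite !rpredD ?homogCM ?homXX.
rewrite redXX scalemx_eq0 expf_eq0 (negPf lk0) /=.
apply: contraNneq abc => /rowP abc0.
by have := abc0 0; have := abc0 1; have := abc0 2; rewrite !mxE /= => -> -> ->.
Qed.

(** The four forms h X_i, h X_j, u, v, with h regular on Z, become dependent when
    restricted to the line lin l = 0.  A dependency gives a linear combination of
    X_i and X_j that vanishes on Z after multiplication by h, hence is zero; what
    remains is a relation between u and v. *)
Lemma vanishing_conics_parallel u v : u \is 2.-homog -> v \is 2.-homog ->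
  vanishes Z u -> vanishes Z v -> red i j k l u != 0 ->
  exists a b : int, a != 0 /\ red i j k l (a%:MP * v + b%:MP * u) = 0.
Proof.
move=> homu homv Zu Zv redu; have [h homh regh] := regular_form_exists cZ fZ wbas dim0.
pose F (x : 'I_4) := nth 0 [:: h * 'X_i; h * 'X_j; u; v] x.
have [c c0 cU] := int_rows_dependent (\matrix_(x < 1 + 3) red i j k l (F x)).
set c0' := c 0 (@Ordinal 4 0 isT); set c1 := c 0 (@Ordinal 4 1 isT).
set c2 := c 0 (@Ordinal 4 2 isT); set c3 := c 0 (@Ordinal 4 3 isT).
have redW : red i j k l (h * (c0'%:MP * 'X_i + c1%:MP * 'X_j) + (c2%:MP * u + c3%:MP * v)) = 0.
  rewrite -cU mulmx_sum_row !big_ord_recl big_ord0 addr0 !rowK /=.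
  rewrite mulrDr !(mulrCA h) !redD !redCM addrA.
  rewrite -!addrA; congr (c 0 _ *: _ + (c 0 _ *: _ + (c 0 _ *: _ + c 0 _ *: _)));
    exact: val_inj.
set A := c0'%:MP * 'X_i + c1%:MP * 'X_j in redW.
have homA : A \is 1.-homog by rewrite rpredD // homogCM ?homogX1.
have homB : c2%:MP * u + c3%:MP * v \is 2.-homog by rewrite rpredD // homogCM.
have ZW : vanishes Z (h * A + (c2%:MP * u + c3%:MP * v)).
  by apply: red0_vanishes redW; rewrite rpredD //; exact: homogM homh homA _.
have ZA : vanishes Z A.
  apply: (regh _ _ homA); rewrite -[h * A](addrK (c2%:MP * u + c3%:MP * v)).
  rewrite -[_ - _]mul1r mulrBr -mulNr; apply: (vanishes_comb cZ); last exact: vanishes_comb.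
  exact: ZW.
have [] := andP uijk; rewrite !inE negb_or => /andP[ij ik] /andP[jk _].
have ZA' : vanishes Z (lin (lcoef A)) by rewrite -homog1E.
have lcoefA x : lcoef A x = c0' * (i == x)%:R + c1 * (j == x)%:R.
  by rewrite /lcoef mcoeffD !mcoeffCM !mcoeffXU.
have par := vanishing_linear_forms_parallel cZ fZ wbas ZA' Zl.
have c0'0 : c0' = 0.
  have /eqP := par i k; rewrite !lcoefA !eqxx [j == i]eq_sym (negPf ij) (negPf ik) (negPf jk).
  by rewrite !mulr0 addr0 mulr1 mul0r mulf_eq0 (negPf lk0) orbF => /eqP.
have c10 : c1 = 0.
  have /eqP := par j k; rewrite !lcoefA !eqxx (negPf ij) (negPf ik) (negPf jk).
  by rewrite !mulr0 add0r mulr1 mul0r mulf_eq0 (negPf lk0) orbF => /eqP.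
have red23 : red i j k l (c3%:MP * v + c2%:MP * u) = 0.
  by rewrite -redW /A c0'0 c10 mpolyC0 !mul0r addr0 mulr0 add0r addrC.
exists c3, c2; split=> //; apply/eqP => c30.
have c20 : c2 = 0.
  apply/eqP; move: red23; rewrite c30 mpolyC0 mul0r add0r redCM => /eqP.
  by rewrite scalemx_eq0 (negPf redu) orbF.
move/eqP: c0; apply; apply/rowP => -[x lt_x4]; rewrite mxE.
move: lt_x4; case: x => [|[|[|[|//]]]] lt_x4.
- by rewrite -[RHS]c0'0; congr (c 0 _); apply: val_inj.
- by rewrite -[RHS]c10; congr (c 0 _); apply: val_inj.
- by rewrite -[RHS]c20; congr (c 0 _); apply: val_inj.
- by rewrite -[RHS]c30; congr (c 0 _); apply: val_inj.
Qed.

Hypothesis lprim : forall p : nat, prime p -> exists a, ~~ (p %| l a)%Z.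

(** A suitable entry of [red] is a functional that, on the quadratic forms vanishing
    on Z, has as kernel the forms F with l_k^2 F divisible by lin l.  By Gauss's
    lemma these F are integral multiples of lin l. *)
Lemma vanishing_quadratic_forms : exists q,
  [/\ q \is 2.-homog, vanishes Z q, red i j k l q != 0 &
    forall F, F \is 2.-homog -> vanishes Z F ->
      exists (c : int) m, F = c%:MP * q + lin l * lin m].
Proof.
have [q0 [homq0 Zq0 redq0]] := vanishing_binary_form.
have /rV0Pn[t redq0t] := redq0.
have [||||q [[homq Zq] qt0 gen]] := @cyclic_mod_kernel _
    [set F | F \is 2.-homog /\ vanishes Z F] (fun F => red i j k l F 0 t) q0.
- move=> u d v; have -> : u - d *: v = u + (- d)%:MP * v.
    by rewrite mpolyCN mulNr mul_mpolyC.
  by rewrite redD redCM !mxE mulNr.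
- move=> u d v [homu Zu] [homv Zv]; split; first by rewrite rpredB ?rpredZ.
  by rewrite -mul_mpolyC -mulNr -[u]mul1r; apply: vanishes_comb.
- by [].
- by [].
have redq : red i j k l q != 0 by apply/rV0Pn; exists t.
exists q; split=> // F homF ZF; have [c /= ct0] := gen F (conj homF ZF).
have homG : F - c *: q \is 2.-homog by rewrite rpredB ?rpredZ.
have ZG : vanishes Z (F - c *: q).
  by rewrite -mul_mpolyC -mulNr -[F]mul1r; exact: vanishes_comb.
have [a [b [a0 red0]]] := vanishing_conics_parallel homq homG Zq ZG redq.
have b0 : b = 0.
  have entry (x y : int) (M N : 'rV_3) : (x *: M + y *: N) 0 t = x * M 0 t + y * N 0 t.
    by rewrite !mxE.
  apply/eqP; move/rowP/(_ t)/eqP: red0; rewrite redD !redCM entry ct0 mulr0 add0r [X in _ == X]mxE.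
  by rewrite mulf_eq0 (negPf qt0) orbF.
move: red0; rewrite b0 mpolyC0 mul0r addr0 redCM => /eqP.
rewrite scalemx_eq0 (negPf a0) /= => /eqP redG.
have [m] := redE l uijk homG; rewrite redG !mxE mpolyC0 !mul0r !addr0.
case/(gauss_linear lprim (expf_neq0 2 lk0)) => m' GE.
by exists c, m'; rewrite -GE mul_mpolyC addrC subrK.
Qed.

End VanishingConics.

(** * The discriminant *)

Lemma det_mx2 (R : comNzRingType) (A : 'M[R]_2) : \det A = A 0 0 * A 1 1 - A 0 1 * A 1 0.
Proof.
rewrite (expand_det_row _ 0) !big_ord_recl big_ord0 addr0 /cofactor !det_mx11 !mxE /=.
rewrite expr0 expr1 mul1r mulN1r mulrN.
congr (A _ _ * A _ _ - A _ _ * A _ _); exact: val_inj.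
Qed.

Section TraceForm.
Variable Z : chart_ideals int.
Hypotheses (cZ : is_closed_subscheme Z) (fZ : is_flat Z).
Variable w : 'I_2 -> {ffun 'I_3 -> {mpoly int[3]}}.
Hypothesis wbas : is_H0_basis Z w.
Variable T : 'I_2 -> 'I_2 -> 'M[int]_2.
Hypothesis TP : forall i j l, null_sections Z
  (section_mul (section_mul (w i) (w j)) (w l) - \sum_m T i j l m *: w m).

Let comb (a : 'rV[int]_2) x := \sum_i (a 0 i)%:MP * w i x.

(** The matrix of multiplication by the product of two functions with
    coordinate vectors a and b. *)
Let mulmat (a b : 'rV[int]_2) : 'M[int]_2 := \sum_i \sum_j (a 0 i * b 0 j) *: T i j.

Lemma comb_free a : (forall x, Z x (comb a x)) -> a = 0.
Proof.
move=> Za; apply: (basis_free cZ wbas) => x; rewrite sum_ffunE; have := Za x.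
by congr (Z x _); apply: eq_bigr => i _; rewrite ffunE mul_mpolyC.
Qed.

Lemma chart_sum x (I : finType) (F : I -> {mpoly int[3]}) :
  (forall i, Z x (F i)) -> Z x (\sum_i F i).
Proof. by move=> ZF; case: (chart_ideal cZ x) => Z0 ZD _; elim/big_ind: _. Qed.

Lemma comb_mul a b c x : Z x (comb a x * comb b x * comb c x - comb (c *m mulmat a b) x).
Proof.
have -> : comb a x * comb b x * comb c x = \sum_i \sum_j \sum_l
    (a 0 i * b 0 j * c 0 l)%:MP * (w i x * w j x * w l x).
  rewrite /comb mulr_suml mulr_suml; apply: eq_bigr => i _.
  rewrite -mulrA mulr_suml mulr_sumr; apply: eq_bigr => j _.
  rewrite !mulr_sumr; apply: eq_bigr => l _.
  by rewrite !mpolyCM; move: (w i x) (w j x) (w l x) => r s t; ring.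
have -> : comb (c *m mulmat a b) x = \sum_i \sum_j \sum_l
    (a 0 i * b 0 j * c 0 l)%:MP * (\sum_m (T i j l m)%:MP * w m x).
  transitivity (\sum_m \sum_i \sum_j \sum_l
      (a 0 i * b 0 j * c 0 l)%:MP * ((T i j l m)%:MP * w m x)); last first.
    rewrite exchange_big; apply: eq_bigr => i _; rewrite exchange_big; apply: eq_bigr => j _.
    by rewrite exchange_big; apply: eq_bigr => l _; rewrite mulr_sumr.
  apply: eq_bigr => m _.
  have -> : (c *m mulmat a b) 0 m = \sum_i \sum_j \sum_l a 0 i * b 0 j * c 0 l * T i j l m.
    rewrite /mulmat mulmx_sumr summxE; apply: eq_bigr => i _.
    rewrite mulmx_sumr summxE; apply: eq_bigr => j _.
    rewrite -scalemxAr !mxE mulr_sumr; apply: eq_bigr => l _.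
    by rewrite mulrA.
  rewrite raddf_sum mulr_suml; apply: eq_bigr => i _.
  rewrite raddf_sum mulr_suml; apply: eq_bigr => j _.
  rewrite raddf_sum mulr_suml; apply: eq_bigr => l _.
  by rewrite /= mpolyCM -mulrA.
rewrite -sumrB; apply: chart_sum => i; rewrite -sumrB; apply: chart_sum => j.
rewrite -sumrB; apply: chart_sum => l; rewrite -mulrBr; apply: (chart_mul cZ).
have := TP i j l x; rewrite !ffunE sum_ffunE; congr (Z x (_ - _)).
by apply: eq_bigr => m _; rewrite ffunE mul_mpolyC.
Qed.

Lemma mulmatP a b c d s t r :
  (forall x, Z x (s x - comb a x)) -> (forall x, Z x (t x - comb b x)) ->
  (forall x, Z x (r x - comb c x)) -> (forall x, Z x (s x * t x * r x - comb d x)) ->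
  d = c *m mulmat a b.
Proof.
move=> Zs Zt Zr Zd; apply/eqP; rewrite -subr_eq0; apply/eqP/comb_free => x.
have -> : comb (d - c *m mulmat a b) x = comb d x - comb (c *m mulmat a b) x.
  by rewrite /comb -sumrB; apply: eq_bigr => i _; rewrite !mxE mpolyCB mulrBl.
have := comb_mul a b c x; move: (Zs x) (Zt x) (Zr x) (Zd x).
move: (comb a x) (comb b x) (comb c x) (comb d x) (comb (c *m mulmat a b) x) (s x) (t x) (r x).
move=> A B C E F S1 T1 R1 ZS ZT ZR ZE ZF.
have -> : E - F = (- 1) * (S1 * T1 * R1 - E) + 1 * (1 * (A * B * C - F) +
   1 * ((A * B) * (R1 - C) + 1 * ((A * R1) * (T1 - B) + (T1 * R1) * (S1 - A)))) by ring.
by do 4!apply: (chart_comb cZ) => //.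
Qed.

(** In the basis 1, delta of the algebra over the rationals, multiplication by
    delta has the matrix with rows (0, 1) and (d, 0), so delta has trace zero.
    Hence 1 and delta span a subring of discriminant 4 d, and this is the
    discriminant of the whole ring times the square of the index det P. *)
Lemma disc_subring (delta : {ffun 'I_3 -> {mpoly int[3]}}) (d : int) :
  sections Z delta -> (forall x, Z x (delta x ^+ 2 - d%:MP)) ->
  (forall a b : int, (forall x, Z x (a%:MP + b%:MP * delta x)) -> a = 0 /\ b = 0) ->
  exists2 P : 'M[int]_2, \det P != 0 &
    \det P ^+ 2 * \det (\matrix_(i, j) \tr (T i j)) = 4 * d.
Proof.
move=> sec_delta delta2 indep.
pose one := [ffun=> 1] : {ffun 'I_3 -> {mpoly int[3]}}.
have Z0 x : Z x 0 by case: (chart_ideal cZ x).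
have sec_one : sections Z one.
  move=> i j; exists 0%N, 1, 1; rewrite !ffunE !subrr; split=> //; [exact: dhomog1|exact: dhomog1|].
  by exists 0%N; rewrite mulr0.
have coords s : sections Z s -> exists a : 'rV[int]_2, forall x, Z x (s x - comb a x).
  move=> /(coordinates wbas)[a Za]; exists a => x; have := Za x.
  rewrite !ffunE sum_ffunE; congr (Z x (_ - _)).
  by apply: eq_bigr => i _; rewrite ffunE mul_mpolyC.
have [u Zu'] := coords _ sec_one; have [v Zv] := coords _ sec_delta.
have Zu x : Z x (1 - comb u x) by have := Zu' x; rewrite ffunE.
pose P : 'M[int]_2 := \matrix_(i, j) (if i == 0 then u 0 j else v 0 j).
have rowP0 : row 0 P = u by apply/rowP=> j; rewrite !mxE.
have rowP1 : row 1 P = v by apply/rowP=> j; rewrite !mxE.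
have combZD c a e b x : comb (c *: a + e *: b) x = c%:MP * comb a x + e%:MP * comb b x.
  rewrite /comb !mulr_sumr -big_split; apply: eq_bigr => i _ /=.
  by rewrite !mxE mpolyCD !mpolyCM mulrDl !mulrA.
have detP0 : \det P != 0.
  apply/negP => /det0P[c /eqP c0 cP]; apply: c0.
  have cuv : c 0 0 *: u + c 0 1 *: v = 0.
    rewrite -[RHS]cP mulmx_sum_row !big_ord_recl big_ord0 addr0 -rowP0 -rowP1.
    congr (_ + c 0 _ *: row _ P); exact: val_inj.
  have [x|a0 b0] := indep (c 0 0) (c 0 1).
    have -> : (c 0 0)%:MP + (c 0 1)%:MP * delta x =
      (c 0 0)%:MP * (1 - comb u x) + 1 * ((c 0 1)%:MP * (delta x - comb v x)
        + 1 * ((c 0 0)%:MP * comb u x + (c 0 1)%:MP * comb v x)).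
      by move: (delta x) (comb u x) (comb v x) => r s t; ring.
    rewrite -combZD cuv; apply: (chart_comb cZ) => //; apply: (chart_comb cZ) => //.
    by rewrite /comb big1 // => i _; rewrite mxE mpolyC0 mul0r.
  apply/rowP => i; rewrite mxE; case: i => -[|[|//]] lt_i2.
    by rewrite -[RHS]a0; congr (c 0 _); apply: val_inj.
  by rewrite -[RHS]b0; congr (c 0 _); apply: val_inj.
have self a x : Z x (comb a x - comb a x) by rewrite subrr.
have scal (c : int) (a : 'rV_2) : c *: a = c *: a + 0 *: a by rewrite scale0r addr0.
have Muu : mulmat u u = 1%:M.
  apply/row_matrixP => i; rewrite !rowE mulmx1.
  rewrite -(mulmatP Zu Zu (self _) (d := delta_mx 0 i)) // => x.
  by rewrite !mul1r subrr.
have Mvv : mulmat v v = d%:M.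
  apply/row_matrixP => i; rewrite !rowE mul_mx_scalar.
  rewrite -(mulmatP Zv Zv (self (delta_mx 0 i)) (d := d *: delta_mx 0 i)) // => x.
  rewrite scal combZD mpolyC0 mul0r addr0; move: (comb _ x) => y.
  have -> : delta x * delta x * y - d%:MP * y = y * (delta x ^+ 2 - d%:MP).
    by move: (delta x) => z; ring.
  exact: chart_mul.
have Muv : u *m mulmat u v = v.
  by rewrite -(mulmatP Zu Zv Zu (d := v)) // => x; rewrite mul1r mulr1.
have Mvu : mulmat v u = mulmat u v.
  apply/row_matrixP => i; rewrite !rowE.
  apply: (mulmatP Zu Zv (self (delta_mx 0 i))) => x.
  have := comb_mul v u (delta_mx 0 i) x; move: (Zu x) (Zv x).
  move: (comb (delta_mx 0 i *m mulmat v u) x) (comb u x) (comb v x)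
    (comb (delta_mx 0 i) x) (delta x) => E U V C D ZU ZV ZE.
  have -> : 1 * D * C - E = (D * C) * (1 - U) + 1 * ((C * U) * (D - V)
    + 1 * (V * U * C - E)) by ring.
  by do 2!apply: (chart_comb cZ) => //; rewrite mul1r.
have vMuv : v *m mulmat u v = d *: u.
  rewrite -(mulmatP Zu Zv Zv (d := d *: u)) // => x.
  rewrite scal combZD mpolyC0 mul0r addr0.
  have -> : 1 * delta x * delta x - d%:MP * comb u x =
     1 * (delta x ^+ 2 - d%:MP) + d%:MP * (1 - comb u x).
    by move: (delta x) (comb u x) => r s; ring.
  exact: chart_comb.
have trMuv : \tr (mulmat u v) = 0.
  pose K : 'M[int]_2 := \matrix_(i, j)
    (if i == 0 then (if j == 0 then 0 else 1) else (if j == 0 then d else 0)).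
  have PK : P *m mulmat u v = K *m P.
    apply/row_matrixP => i; rewrite !row_mul.
    have -> : row i K *m P = K i 0 *: u + K i 1 *: v.
      rewrite mulmx_sum_row !big_ord_recl big_ord0 addr0 -rowP0 -rowP1 ![row i K _ _]mxE.
      congr (K i _ *: row _ P + K i _ *: row _ P); exact: val_inj.
    have [->|i0] := eqVneq i 0.
      by rewrite rowP0 Muv !mxE /= scale0r scale1r add0r.
    have -> : i = 1 by apply: val_inj; case: i i0 => -[|[|]].
    by rewrite rowP1 vMuv !mxE /= scale0r addr0.
  apply: (mulfI detP0); rewrite mulr0.
  have : \tr (\adj P *m (P *m mulmat u v)) = \det P * \tr K.
    by rewrite PK mulmxA mxtrace_mulC mulmxA mul_mx_adj mul_scalar_mx mxtraceZ.
  rewrite mulmxA mul_adj_mx mul_scalar_mx mxtraceZ => ->.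
  by rewrite /mxtrace !big_ord_recl big_ord0 !mxE /= !addr0 mulr0.
exists P => //; set B := \matrix_(i, j) _.
have trB a b : (a *m B *m b^T) 0 0 = \tr (mulmat a b).
  rewrite mxE raddf_sum /=.
  under eq_bigr do rewrite !mxE mulr_suml.
  rewrite exchange_big; apply: eq_bigr => i _ /=.
  rewrite raddf_sum /=; apply: eq_bigr => j _.
  by rewrite mxtraceZ !mxE mulrAC.
have entry (i j : 'I_2) : (P *m B *m P^T) i j = \tr (mulmat (row i P) (row j P)).
  rewrite -trB -row_mul mxE [RHS]mxE; apply: eq_bigr => k _.
  by rewrite [row i _ _ _]mxE [P^T k j]mxE [_^T k 0]mxE [row j P _ _]mxE.
have -> : \det P ^+ 2 * \det B = \det (P *m B *m P^T).
  by rewrite !det_mulmx det_tr expr2 mulrAC.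
rewrite det_mx2 !entry rowP0 rowP1 Mvu trMuv Muu Mvv !mxtrace_scalar; ring.
Qed.

End TraceForm.

(** * A square root of the discriminant on Z *)

Section SquareRoot.
Variables (l : 'I_3 -> int) (q : {mpoly int[3]}).
Hypothesis homq : q \is 2.-homog.

(** The discriminant of q restricted to the line lin l = 0: minus four times
    the value at l of the adjoint quadratic form of q. *)
Definition line_disc (i j k : 'I_3) : int :=
  let c := qcoef q in
  l k ^+ 2 * (c i j ^+ 2 - 4 * c i i * c j j)
  + l j ^+ 2 * (c i k ^+ 2 - 4 * c i i * c k k)
  + l i ^+ 2 * (c j k ^+ 2 - 4 * c j j * c k k)
  + l i * l j * (4 * c k k * c i j - 2 * c i k * c j k)
  + l i * l k * (4 * c j j * c i k - 2 * c i j * c j k)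
  + l j * l k * (4 * c i i * c j k - 2 * c i j * c i k).

Lemma line_disc_rot i j k : line_disc i j k = line_disc j k i.
Proof.
rewrite /line_disc /= (qcoefC q k i) (qcoefC q j i).
move: (qcoef q) => c; ring.
Qed.

(** The i-th coordinate of the cross product of the gradient of q with l, for
    (i, j, k) a cyclic permutation of the indices. *)
Definition cross_grad (i j k : 'I_3) : {mpoly int[3]} :=
  let c := qcoef q in
  (l k)%:MP * (2 * (c j j)%:MP * 'X_j + (c i j)%:MP * 'X_i + (c j k)%:MP * 'X_k)
  - (l j)%:MP * (2 * (c k k)%:MP * 'X_k + (c i k)%:MP * 'X_i + (c j k)%:MP * 'X_j).

Lemma cross_grad_homog i j k : cross_grad i j k \is 1.-homog.
Proof.
have hom2 c x : 2 * c%:MP * 'X_x \is [in int[3], 1.-homog].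
  by rewrite -mulrA mulrDl mul1r rpredD // homogCM ?homogX1.
by rewrite /cross_grad /= rpredB // homogCM ?rpredD ?hom2 ?homogCM ?homogX1.
Qed.

(** With X the vector of coordinates, X cross (grad q cross l) equals
    (X . l) grad q - (X . grad q) l, and X . grad q = 2 q. *)
Lemma cross_grad_swap i j k : uniq [:: i; j; k] -> exists2 G, G \is 1.-homog &
  'X_j * cross_grad i j k - 'X_i * cross_grad j k i = (2 * l k)%:MP * q - lin l * G.
Proof.
move=> uijk; pose c := qcoef q.
exists ((2 * c k k)%:MP * 'X_k + (c i k)%:MP * 'X_i + (c j k)%:MP * 'X_j).
  by rewrite !rpredD ?homogCM ?homogX1.
rewrite (linE l uijk) {1}(homog2E uijk homq) /quad /cross_grad /=.
rewrite (qcoefC q k i) (qcoefC q j i) -/c.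
move: (c i i) (c j j) (c k k) (c i j) (c i k) (c j k) (l i) (l j) (l k).
move: 'X_i 'X_j 'X_k => x y z a11 a22 a33 a12 a13 a23 u v w; ring.
Qed.

(** Let B be the symmetric bilinear form of q, let e be the cross product of l
    and the i-th basis vector, and let D be minus four times the adjoint quadratic
    form of q.  Up to sign, cross_grad is 2 B(x, e), and
    4 (B(x, e)^2 - q(x) q(e)) = D(x cross e), where x cross e is x_i l up to sign
    for a point x of the line lin l = 0.  The integer n is 4 q(e). *)
Lemma cross_grad_sqr i j k : uniq [:: i; j; k] -> exists (n : int) G,
  cross_grad i j k ^+ 2 - (line_disc i j k)%:MP * 'X_i ^+ 2 = n%:MP * q + G * lin l.
Proof.
move=> uijk; pose c := qcoef q.
exists (4 * (c j j * l k ^+ 2 + c k k * l j ^+ 2 - c j k * l j * l k)).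
exists ((c j k ^+ 2 - 4 * c j j * c k k)%:MP * lin l -
  (2 * l i * (c j k ^+ 2 - 4 * c j j * c k k) + l j * (4 * c k k * c i j - 2 * c i k * c j k)
   + l k * (4 * c j j * c i k - 2 * c i j * c j k))%:MP * 'X_i).
rewrite (linE l uijk) {1}(homog2E uijk homq) /quad /cross_grad /line_disc /= -/c.
move: (c i i) (c j j) (c k k) (c i j) (c i k) (c j k) (l i) (l j) (l k).
move: 'X_i 'X_j 'X_k => x y z a11 a22 a33 a12 a13 a23 u v w; ring.
Qed.

End SquareRoot.

Section DiscriminantBound.
Variable Z : chart_ideals int.
Hypotheses (cZ : is_closed_subscheme Z) (fZ : is_flat Z).
Variable w : 'I_2 -> {ffun 'I_3 -> {mpoly int[3]}}.
Hypothesis wbas : is_H0_basis Z w.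
Variable T : 'I_2 -> 'I_2 -> 'M[int]_2.
Hypothesis TP : forall i j l, null_sections Z
  (section_mul (section_mul (w i) (w j)) (w l) - \sum_m T i j l m *: w m).
Variables (l : 'I_3 -> int) (q : {mpoly int[3]}) (i j k : 'I_3).
Hypotheses (homq : q \is 2.-homog) (Zl : vanishes Z (lin l)) (Zq : vanishes Z q).
Hypothesis genl : forall F, F \is 1.-homog -> vanishes Z F ->
  exists c : int, F = c%:MP * lin l.
(* The indices form a cyclic permutation of 0, 1, 2. *)
Hypotheses (ij : j = i + 1) (jk : k = j + 1) (lk0 : l k != 0).
Hypothesis redq : red i j k l q != 0.

Lemma cyclic_uniq (x : 'I_3) : uniq [:: x; x + 1; x + 1 + 1].
Proof. by case: x => -[|[|[|]]]. Qed.

Lemma cyclic3 (x : 'I_3) : x + 1 + 1 + 1 = x.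
Proof. by apply: val_inj; case: x => -[|[|[|]]]. Qed.

(** The linear form on the chart x stands for its quotient by X_x. *)
Definition sqrt_disc : {ffun 'I_3 -> {mpoly int[3]}} :=
  [ffun x => cross_grad l q x (x + 1) (x + 1 + 1)].

Lemma sqrt_disc_swap x y : exists (n : int) G, G \is 1.-homog /\
  'X_y * sqrt_disc x - 'X_x * sqrt_disc y = n%:MP * q + G * lin l.
Proof.
have next z : exists (n : int) G, G \is 1.-homog /\
    'X_(z + 1) * sqrt_disc z - 'X_z * sqrt_disc (z + 1) = n%:MP * q + G * lin l.
  have [G homG E] := cross_grad_swap l homq (cyclic_uniq z).
  exists (2 * l (z + 1 + 1)), (- G); split; first by rewrite rpredN.
  by rewrite !ffunE cyclic3 E mulNr [G * _]mulrC.
have [->|yx] := eqVneq y x.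
  by exists 0, 0; split; [apply: rpred0|rewrite subrr mpolyC0 !mul0r addr0].
have [->//|yx1] := eqVneq y (x + 1).
have -> : x = y + 1.
  have := mem_three y (cyclic_uniq x); rewrite (negPf yx) (negPf yx1) /= => /eqP->.
  by rewrite cyclic3.
have [n [G [homG E]]] := next y; exists (- n), (- G); split; first by rewrite rpredN.
by rewrite -opprB E mpolyCN !mulNr opprD.
Qed.

Lemma sqrt_disc_homog x : sqrt_disc x \is 1.-homog.
Proof. by rewrite ffunE cross_grad_homog. Qed.

Lemma sqrt_disc_section : sections Z sqrt_disc.
Proof.
move=> x y; exists 1%N, (sqrt_disc x), (sqrt_disc y); rewrite !sqrt_disc_homog.
have [n [G [_ E]]] := sqrt_disc_swap x y.
split=> //; try by rewrite subrr; case: (chart_ideal cZ x); case: (chart_ideal cZ y).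
exists 0%N; rewrite expr0 mul1r !expr1 E; exact: chart_comb.
Qed.

Lemma sqrt_disc_sqr x : Z x (sqrt_disc x ^+ 2 - (line_disc l q i j k)%:MP).
Proof.
have disc z : line_disc l q z (z + 1) (z + 1 + 1) =
    line_disc l q (z + 1) (z + 1 + 1) (z + 1 + 1 + 1).
  by rewrite line_disc_rot cyclic3.
have -> : line_disc l q i j k = line_disc l q x (x + 1) (x + 1 + 1).
  rewrite jk ij; have := mem_three x (cyclic_uniq i).
  by case/or3P=> /eqP->; [|apply: disc|apply: etrans (disc _) (disc _)].
have [n [G E]] := cross_grad_sqr l homq (cyclic_uniq x); rewrite -/(sqrt_disc x) in E.
have -> : sqrt_disc x ^+ 2 - (line_disc l q x (x + 1) (x + 1 + 1))%:MP =
    1 * (n%:MP * q + G * lin l)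
    + (line_disc l q x (x + 1) (x + 1 + 1))%:MP * ('X_x ^+ 2 - 1).
  by rewrite -E ffunE; move: (cross_grad _ _ _ _ _) ('X_x) => u v; ring.
by apply: (chart_comb cZ) (chart_X1 cZ _ _); apply: chart_comb.
Qed.

(** If a + b sqrt_disc is zero, all the linear forms a X_x + b sqrt_disc_x vanish on
    Z and so are multiples of lin l.  By [cross_grad_swap], lin l then divides
    2 b l_k q, which forces b = 0. *)
Lemma sqrt_disc_independent (a b : int) :
  (forall x, Z x (a%:MP + b%:MP * sqrt_disc x)) -> a = 0 /\ b = 0.
Proof.
move=> Zab; pose G x := a%:MP * 'X_x + b%:MP * sqrt_disc x.
have homG x : G x \is 1.-homog.
  by rewrite rpredD ?homogCM ?homogX1 ?sqrt_disc_homog.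
have ZG x : Z x (G x).
  have -> : G x = 1 * (a%:MP + b%:MP * sqrt_disc x) + a%:MP * ('X_x ^+ 1 - 1).
    by rewrite /G; move: (sqrt_disc x) 'X_x => u v; ring.
  exact: (chart_comb cZ) (chart_X1 cZ _ _).
have swap x y : 'X_y * G x - 'X_x * G y =
    b%:MP * ('X_y * sqrt_disc x - 'X_x * sqrt_disc y).
  by rewrite /G; move: (sqrt_disc x) (sqrt_disc y) 'X_x 'X_y => u v u' v'; ring.
have /choice[c GE] x : exists c : int, G x = c%:MP * lin l.
  apply: genl (homG x) _ => y; apply: (@chart_Xn _ cZ y 1).
  have [n [H [_ E]]] := sqrt_disc_swap x y.
  have -> : 'X_y ^+ 1 * G x = 1 * (b%:MP * (n%:MP * q + H * lin l)) + 'X_x * G y.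
    by rewrite expr1 mul1r -E -swap subrK.
  apply: (chart_comb cZ) (ZG y); apply: (chart_mul cZ); exact: chart_comb.
have uijk : uniq [:: i; j; k] by rewrite jk ij cyclic_uniq.
have red_mul H : H \is 1.-homog -> red i j k l (lin l * H) = 0.
  by move=> homH; rewrite (homog1E homH) red_lin_mul.
have b0 : b = 0.
  have [H homH E] := cross_grad_swap l homq uijk.
  have dij : 'X_j * sqrt_disc i - 'X_i * sqrt_disc j = (2 * l k)%:MP * q - lin l * H.
    by rewrite -E !ffunE jk ij cyclic3.
  have : (b * (2 * l k))%:MP * q = lin l * ((c i)%:MP * 'X_j - (c j)%:MP * 'X_i + b%:MP * H).
    have sw := swap i j; rewrite dij !GE in sw.
    have -> : (b * (2 * l k))%:MP * q =
        b%:MP * ((2 * l k)%:MP * q - lin l * H) + b%:MP * (lin l * H).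
      by move: (lin l) => L; ring.
    by rewrite -sw; move: (lin l) 'X_i 'X_j => L x y; ring.
  move/(congr1 (red i j k l)); rewrite redCM red_mul; last first.
    by rewrite rpredD ?rpredB ?homogCM ?homogX1.
  move/eqP; rewrite scalemx_eq0 (negPf redq) orbF !mulf_eq0 (negPf lk0) orbF.
  by case/orP=> /eqP.
split=> //; have [x Zx1] := not_vanishes1 cZ wbas.
apply/eqP/negPn/negP => a0; apply: Zx1; apply: (chart_flat fZ a0).
by have := Zab x; rewrite b0 mpolyC0 mul0r addr0 mulr1.
Qed.

Lemma disc_le : `|\det (\matrix_(a, b) \tr (T a b))| <= 4 * `|line_disc l q i j k|.
Proof.
have [P P0 E] := disc_subring cZ wbas TP sqrt_disc_section sqrt_disc_sqr
  sqrt_disc_independent.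
move: (\det (\matrix_(a, b) _)) E => D E.
rewrite -[4]ger0_norm // -normrM -E normrM ler_peMl //.
rewrite normrX exprn_ege1 //; lia.
Qed.

End DiscriminantBound.

(** * Covolumes *)

Lemma lattice_basis (L : set {mpoly int[3]}) n (w : 'I_n -> {mpoly int[3]}) :
  (forall i, L (w i)) ->
  (forall v, L v -> exists a : 'rV[int]_n, v = \sum_i a 0 i *: w i) ->
  (forall a : 'rV[int]_n, \sum_i a 0 i *: w i = 0 -> a = 0) ->
  is_quot_basis L [set 0] w.
Proof.
move=> Lw gen free; split=> // v /gen[a ->]; exists a; split; first by rewrite /= subrr.
move=> b /= ab; apply/eqP; rewrite -subr_eq0; apply/eqP/free; rewrite -[RHS]ab -sumrB.
by apply: eq_bigr => i _; rewrite !mxE scalerBl.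
Qed.

(** Laplace expansion along the first row in a form that computes. *)
Fixpoint laplace (R : comNzRingType) n (f : nat -> nat -> R) : R :=
  if n isn't m.+1 then 1 else foldr (fun j s =>
    f 0 j * ((-1) ^+ j * laplace m (fun x y => f x.+1 (bump j y))) + s) 0 (iota 0 n).

Lemma det_laplace (R : comNzRingType) n (f : nat -> nat -> R) :
  \det (\matrix_(i < n, j < n) f i j) = laplace n f.
Proof.
elim: n f => [|n IHn] f; first by rewrite det_mx00.
rewrite (expand_det_row _ ord0) [laplace _ _]/=.
pose F j := f 0 j * ((-1) ^+ j * laplace n (fun x y => f x.+1 (bump j y))).
transitivity (\sum_(j < n.+1) F j).
  apply: eq_bigr => j _; rewrite mxE /cofactor /F -IHn /=.
  by congr (_ * (_ * \det _)); apply/matrixP=> a b; rewrite !mxE.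
rewrite -(big_mkord xpredT F) /index_iota subn0 [RHS](_ : _ = foldr (fun j s => F j + s) 0 (iota 0 n.+1)) //.
by elim: (iota 0 n.+1) => [|j s IHs]; rewrite ?big_nil // big_cons IHs.
Qed.

Section ConicGram.
Variables (i j k : 'I_3) (l : 'I_3 -> int) (q : {mpoly int[3]}).
Hypotheses (uijk : uniq [:: i; j; k]) (homq : q \is 2.-homog).

Definition conic_basis (x : 'I_4) : {mpoly int[3]} :=
  nth 0 [:: lin l * 'X_i; lin l * 'X_j; lin l * 'X_k; q] x.

Lemma conic_basis_homog x : conic_basis x \is 2.-homog.
Proof.
have homlX a : lin l * 'X_a \is 2.-homog by exact: homogM (lin_homog l) (homogX1 a) _.
by case: x => -[|[|[|[|//]]]] lt_x4; rewrite /conic_basis /= ?homlX.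
Qed.

Lemma mdeg_mon2 (a b : 'I_3) : (mdeg (U_(a) + U_(b))%MM < 3)%N.
Proof. by rewrite mdegD !mdeg1. Qed.

Lemma gram_minor (c : 4.-tuple ('I_3 * 'I_3)) :
  \det (\matrix_(x < 4, y < 4) qcoef (conic_basis x) (tnth c y).1 (tnth c y).2) ^+ 2
    <= \det (gram conic_basis) *+ 24.
Proof.
have size_hom x : (msize (conic_basis x) <= 3)%N.
  rewrite msizeE; apply/bigmax_leqP_seq => m msup _.
  by have /= -> := dhomog_mf (conic_basis_homog x) msup.
have -> : gram conic_basis =
    \matrix_(x, y) \sum_(m : 'X_{1..3 < 3}) (conic_basis x)@_m * (conic_basis y)@_m.
  by apply/matrixP=> x y; rewrite !mxE (mono_dotE _ (size_hom x)).
rewrite (gram_det_sum_sqr (fun x (m : 'X_{1..3 < 3}) => (conic_basis x)@_m)).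
rewrite (bigD1 [ffun y => BMultinom (mdeg_mon2 (tnth c y).1 (tnth c y).2)]) //=.
rewrite -[X in X <= _]addr0 lerD //; last by apply: sumr_ge0 => f _; exact: sqr_ge0.
rewrite le_eqVlt; apply/orP; left; apply/eqP; congr (\det _ ^+ 2).
by apply/matrixP=> x y; rewrite !mxE ffunE.
Qed.

(** The minor in the columns X_i X_k, X_j X_k, X_k^2 and one of the three other
    monomials: its first three rows eliminate X_k from q. *)
Lemma conic_minor (a b : 'I_3) (u v : int) :
  (forall r : 'I_3, qcoef (lin l * 'X_r) a b = [fun r => 0 with i |-> u, j |-> v] r) ->
  l k * (qcoef q a b * l k ^+ 2 - qcoef q i k * u * l k - qcoef q j k * v * l k
    + qcoef q k k * (l i * u + l j * v)) =
  \det (\matrix_(x < 4, y < 4) qcoef (conic_basis x)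
     (tnth [tuple (i, k); (j, k); (k, k); (a, b)] y).1
     (tnth [tuple (i, k); (j, k); (k, k); (a, b)] y).2).
Proof.
move=> col.
have [] := andP uijk; rewrite !inE negb_or => /andP[ij ik] /andP[jk _].
have ji : j != i by rewrite eq_sym.
have ki : k != i by rewrite eq_sym.
have kj : k != j by rewrite eq_sym.
pose f (x y : nat) : int := nth 0 (nth [::]
  [:: [:: l k; 0; 0; u]; [:: 0; l k; 0; v]; [:: l i; l j; l k; 0];
      [:: qcoef q i k; qcoef q j k; qcoef q k k; qcoef q a b]] x) y.
transitivity (\det (\matrix_(x < 4, y < 4) f x y)); last first.
  congr (\det _); apply/matrixP => -[x lt_x4] [y lt_y4]; rewrite !mxE (tnth_nth (i, i)).
  rewrite /conic_basis /f /=.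
  by case: x lt_x4 => [|[|[|[|//]]]] _; case: y lt_y4 => [|[|[|[|//]]]] _ //=;
    rewrite ?col ?qcoef_linX /= ?eqxx ?(negPf ij) ?(negPf ik) ?(negPf jk) ?(negPf ji)
      ?(negPf ki) ?(negPf kj) /= ?mul1r ?mul0r ?addr0 ?add0r.
rewrite det_laplace /f /= /bump /=.
move: (l i) (l j) (l k) (qcoef q i k) (qcoef q j k) (qcoef q k k) (qcoef q a b).
move=> A B C D E F G; ring.
Qed.

(** The entries A, B, C of [red] satisfy B^2 - 4 A C = l_k^2 line_disc, and
    |B^2 - 4 A C| <= 2 (A^2 + B^2 + C^2), where l_k A, l_k B and l_k C are minors. *)
Lemma conic_gram_ge : l k ^+ 4 * `|line_disc l q i j k| <= 144 * \det (gram conic_basis).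
Proof.
have [] := andP uijk; rewrite !inE negb_or => /andP[ij ik] /andP[jk _].
have ji : j != i by rewrite eq_sym.
have ki : k != i by rewrite eq_sym.
have kj : k != j by rewrite eq_sym.
have minor (a b : 'I_3) u v E : (a, b) \in [:: (i, i); (i, j); (j, j)] ->
    [/\ qcoef (lin l * 'X_i) a b = u, qcoef (lin l * 'X_j) a b = v &
      E = qcoef q a b * l k ^+ 2 - qcoef q i k * u * l k - qcoef q j k * v * l k
          + qcoef q k k * (l i * u + l j * v)] ->
    (l k * E) ^+ 2 <= 24 * \det (gram conic_basis).
  move=> abij [uE vE ->]; rewrite mulr_natl conic_minor ?gram_minor // => r.
  rewrite -uE -vE; case/or3P: (mem_three r uijk) => /eqP->; rewrite /= ?eqxx ?(negPf ji)
    ?(negPf ki) ?(negPf kj) // qcoef_linX.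
  by move: abij; rewrite !inE => /or3P[] /eqP[-> ->];
    rewrite ?eqxx ?(negPf ik) ?(negPf jk) !mul0r addr0.
set c := qcoef q.
have lX := qcoef_linX l.
pose A := c i i * l k ^+ 2 - c i k * l i * l k + c k k * l i ^+ 2.
pose B := c i j * l k ^+ 2 - c i k * l j * l k - c j k * l i * l k + 2 * c k k * l i * l j.
pose C := c j j * l k ^+ 2 - c j k * l j * l k + c k k * l j ^+ 2.
have mA : (l k * A) ^+ 2 <= 24 * \det (gram conic_basis).
  apply: (minor i i (l i) 0); first by rewrite !inE eqxx.
  split; rewrite ?lX ?eqxx ?(negPf ij) /= ?mul1r ?mul0r ?addr0 //.
  by rewrite /A -/c; move: (c i i) (c i k) (c j k) (c k k) => p r s t; ring.
have mB : (l k * B) ^+ 2 <= 24 * \det (gram conic_basis).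
  apply: (minor i j (l j) (l i)); first by rewrite !inE eqxx orbT.
  split; rewrite ?lX ?eqxx ?(negPf ij) ?(negPf ji) /= ?mul1r ?mul0r ?addr0 ?add0r //.
  by rewrite /B -/c; move: (c i j) (c i k) (c j k) (c k k) => p r s t; ring.
have mC : (l k * C) ^+ 2 <= 24 * \det (gram conic_basis).
  apply: (minor j j 0 (l j)); first by rewrite !inE eqxx !orbT.
  split; rewrite ?lX ?eqxx ?(negPf ij) ?(negPf ji) /= ?mul1r ?mul0r ?addr0 //.
  by rewrite /C -/c; move: (c j j) (c i k) (c j k) (c k k) => p r s t; ring.
have -> : l k ^+ 4 * `|line_disc l q i j k| = `|(l k * B) ^+ 2 - 4 * (l k * A) * (l k * C)|.
  rewrite -[l k ^+ 4]ger0_norm; last by rewrite (exprM _ 2 2) sqr_ge0.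
  rewrite -normrM /line_disc /A /B /C /= -/c; congr `|_|.
  move: (c i i) (c j j) (c k k) (c i j) (c i k) (c j k) (l i) (l j) (l k).
  by move=> c1 c2 c3 c4 c5 c6 x y z; ring.
move: (l k * A) (l k * B) (l k * C) (\det _) mA mB mC => x y z g mA mB mC.
rewrite ler_norml; apply/andP; split; nra.
Qed.

End ConicGram.

Lemma lin_eq0 l : lin l = 0 -> forall x, l x = 0.
Proof. by move=> l0 x; rewrite -(lcoef_lin l) l0 /lcoef mcoeff0. Qed.

Lemma line_lattice_basis (Z : chart_ideals int) l k : vanishes Z (lin l) -> l k != 0 ->
  (forall F, F \is 1.-homog -> vanishes Z F -> exists c : int, F = c%:MP * lin l) ->
  is_quot_basis (vanishing_forms Z 1) [set 0] (fun _ : 'I_1 => lin l).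
Proof.
move=> Zl lk0 gen; apply: lattice_basis => [_|v [homv Zv]|a].
- by split=> //; apply: lin_homog.
- have [c ->] := gen v homv Zv; exists (const_mx c).
  by rewrite big_ord1 mxE mul_mpolyC.
rewrite big_ord1 -mul_mpolyC => /(congr1 (lcoef ^~ k)).
rewrite /lcoef mcoeffCM mcoeff0 -/(lcoef _ k) lcoef_lin => /eqP.
rewrite mulf_eq0 (negPf lk0) orbF => /eqP a0.
by apply/rowP=> x; rewrite ord1 a0 mxE.
Qed.

Lemma conic_lattice_basis (Z : chart_ideals int) l q i j k :
  is_closed_subscheme Z -> uniq [:: i; j; k] -> vanishes Z (lin l) -> l k != 0 ->
  q \is 2.-homog -> vanishes Z q -> red i j k l q != 0 ->
  (forall F, F \is 2.-homog -> vanishes Z F ->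
     exists (c : int) m, F = c%:MP * q + lin l * lin m) ->
  is_quot_basis (vanishing_forms Z 2) [set 0] (conic_basis i j k l q).
Proof.
move=> cZ uijk Zl lk0 homq Zq redq gen.
pose o x (lt : (x < 4)%N) : 'I_4 := Ordinal lt.
have sumE (a : 'rV[int]_4) : \sum_x a 0 x *: conic_basis i j k l q x =
    (a 0 (@o 3 isT))%:MP * q + lin l * ((a 0 (@o 0 isT))%:MP * 'X_i
      + (a 0 (@o 1 isT))%:MP * 'X_j + (a 0 (@o 2 isT))%:MP * 'X_k).
  rewrite !big_ord_recl big_ord0 addr0 /conic_basis /= !addrA addrC !mulrDr.
  rewrite !(mulrCA (lin l)) !mul_mpolyC.
  congr (a 0 _ *: _ + (a 0 _ *: _ + a 0 _ *: _ + a 0 _ *: _)); exact: val_inj.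
apply: lattice_basis => [x|v [homv Zv]|a].
- split; first exact: conic_basis_homog.
  rewrite /conic_basis; case: x => -[|[|[|[|//]]]] lt_x4 //= c;
    by rewrite mulrC; apply: chart_mul.
- have [c [m ->]] := gen v homv Zv.
  by exists (\row_x [:: m i; m j; m k; c]`_x); rewrite sumE !mxE (linE m uijk).
rewrite sumE => E.
have homA : (a 0 (@o 0 isT))%:MP * 'X_i + (a 0 (@o 1 isT))%:MP * 'X_j
    + (a 0 (@o 2 isT))%:MP * 'X_k \is 1.-homog by rewrite !rpredD ?homogCM ?homogX1.
have a3 : a 0 (@o 3 isT) = 0.
  move: E => /(congr1 (red i j k l)); rewrite redD redCM (homog1E homA) red_lin_mul // addr0.
  have -> : red i j k l 0 = 0 by have := redCM i j k l 0 q; rewrite mpolyC0 mul0r scale0r.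
  move/eqP.
  by rewrite scalemx_eq0 (negPf redq) orbF => /eqP.
move: E; rewrite a3 mpolyC0 mul0r add0r => /eqP; rewrite mulf_eq0 => /orP[/eqP/lin_eq0|/eqP A0].
  by move=> /(_ k)/eqP; rewrite (negPf lk0).
have lA x : lcoef 0 x = (a 0 (@o 0 isT)) * (i == x)%:R + (a 0 (@o 1 isT)) * (j == x)%:R
    + (a 0 (@o 2 isT)) * (k == x)%:R.
  by rewrite -A0 /lcoef !mcoeffD !mcoeffCM !mcoeffXU.
have [] := andP uijk; rewrite !inE negb_or => /andP[ij ik] /andP[jk _].
have ji : j != i by rewrite eq_sym.
have ki : k != i by rewrite eq_sym.
have kj : k != j by rewrite eq_sym.
have := lA i; have := lA j; have := lA k; rewrite /lcoef !mcoeff0.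
rewrite !eqxx (negPf ij) (negPf ik) (negPf jk) (negPf ji) (negPf ki) (negPf kj).
rewrite !mulr0 !mulr1 !addr0 !add0r => a2 a1 a0.
apply/rowP => -[x lt_x4]; rewrite mxE; move: lt_x4; case: x => [|[|[|[|//]]]] lt_x4.
- by apply: etrans _ (esym a0); congr (a 0 _); apply: val_inj.
- by apply: etrans _ (esym a1); congr (a 0 _); apply: val_inj.
- by apply: etrans _ (esym a2); congr (a 0 _); apply: val_inj.
- by rewrite -[RHS]a3; congr (a 0 _); apply: val_inj.
Qed.

Lemma gram_line l : \det (gram (fun _ : 'I_1 => lin l)) = \sum_x l x ^+ 2.
Proof.
rewrite det_mx11 mxE {2}/lin; under eq_bigr do rewrite mul_mpolyC.
rewrite mono_dot_sumr; apply: eq_bigr => x _; rewrite expr2; congr (_ * _).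
by rewrite mono_dotC /mono_dot msuppX big_seq1 mcoeffX eqxx mul1r -/(lcoef _ x) lcoef_lin.
Qed.

Lemma height_covolE (R : realType) (Z : chart_ideals int) m n
    (u : 'I_m -> {mpoly int[3]}) (v : 'I_n -> {mpoly int[3]}) :
  is_quot_basis (vanishing_forms Z 1) [set 0] u ->
  is_quot_basis (vanishing_forms Z 2) [set 0] v ->
  0 < \det (gram u) -> 0 <= \det (gram v) ->
  height (-2) 2 Z = (\det (gram v))%:~R / (\det (gram u))%:~R ^+ 2 :> R.
Proof.
move=> ubas vbas u0 v0; rewrite /height (covolE R ubas) (covolE R vbas).
have -> : -2 - 2 = - (4%:R) :> R by ring.
rewrite powR_invn ?sqrtr_ge0 // powR_mulrn ?sqrtr_ge0 // sqr_sqrtr ?ler0z //.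
by rewrite mulrC (exprM _ 2 2) sqr_sqrtr // ler0z ltW.
Qed.

Lemma max_coefficient (l : 'I_3 -> int) k0 : l k0 != 0 ->
  exists k, l k != 0 /\ \sum_x l x ^+ 2 <= 3 * l k ^+ 2.
Proof.
move=> lk0; case: (arg_maxnP (fun x => `|l x|%N) (isT : xpredT k0)) => k _ kmax.
exists k; split; first by apply: contraNneq lk0 => lk; have := kmax k0 isT; lia.
have le x : l x ^+ 2 <= l k ^+ 2.
  have /= := kmax x isT; rewrite -[l x ^+ 2]real_normK ?num_real //.
  rewrite -[l k ^+ 2]real_normK ?num_real // => lexk; rewrite ler_sqr ?nnegrE //; lia.
by rewrite !big_ord_recl big_ord0 addr0; have := le 0; have := le (lift 0 0);
  have := le (lift 0 (lift 0 0)); lra.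
Qed.

Theorem proposition32 (R : realType) :
  exists C : R, 0 < C /\
    forall Z : chart_ideals int, Hilb2P2 Z ->
      (`|Disc Z|)%:~R <= C * height (-2) 2 Z.
Proof.
(* 5184 = 4 * 9 * 144, the product of the constants in [disc_le], in the square of
   [max_coefficient] and in [conic_gram_ge]. *)
exists 5184%:R; split=> // Z [cZ fZ [dim0 _] _].
rewrite /Disc; case: xgetP => [_ _ [w [wbas [T [TP ->]]]]|_]; last first.
  by rewrite normr0 mulr_ge0 // mulr_ge0 // exp.powR_ge0.
have [l [Zl [k0 lk0] genl lprim]] := vanishing_linear_forms cZ fZ dim0 wbas.
have [k [{k0}lk0 lk_max]] := max_coefficient lk0.
pose i := k + 1; pose j := i + 1.
have kE : k = j + 1 by rewrite /j /i cyclic3.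
have uijk : uniq [:: i; j; k] by rewrite kE cyclic_uniq.
have [q [homq Zq redq genq]] := vanishing_quadratic_forms cZ fZ dim0 wbas Zl uijk lk0 lprim.
have ubas := line_lattice_basis Zl lk0 genl.
have vbas := conic_lattice_basis cZ uijk Zl lk0 homq Zq redq genq.
have leD := disc_le cZ fZ wbas TP homq Zl Zq genl (erefl j) kE lk0 redq.
have leg := conic_gram_ge l uijk homq.
have lk2 : 0 < l k ^+ 2 by rewrite lt_def sqrf_eq0 lk0 sqr_ge0.
have g1_gt0 : 0 < \det (gram (fun _ : 'I_1 => lin l)).
  rewrite gram_line (bigD1 k) //=; apply: ltr_wpDr => //.
  by apply: sumr_ge0 => x _; apply: sqr_ge0.
have g2_ge0 : 0 <= \det (gram (conic_basis i j k l q)).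
  rewrite -(pmulr_rge0 _ (isT : 0 < 144 :> int)); apply: le_trans leg.
  by rewrite mulr_ge0 // (exprM _ 2 2) sqr_ge0.
rewrite (height_covolE R ubas vbas) // mulrA ler_pdivlMr; last first.
  by rewrite exprn_gt0 // ltr0z.
rewrite -rmorphXn -rmorphM -[5184%:R]/(5184%:~R) -rmorphM ler_int gram_line.
rewrite gram_line in g1_gt0.
have sqr_g1 : (\sum_x l x ^+ 2) ^+ 2 <= 9 * l k ^+ 4.
  have -> : 9 * l k ^+ 4 = (3 * l k ^+ 2) ^+ 2 by rewrite exprMn -exprM.
  by rewrite ler_sqr // nnegrE ?(ltW g1_gt0) // mulr_ge0 // sqr_ge0.
apply: le_trans (ler_pM (normr_ge0 _) (sqr_ge0 _) leD sqr_g1) _.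
have -> : 4 * `|line_disc l q i j k| * (9 * l k ^+ 4) =
  36 * (l k ^+ 4 * `|line_disc l q i j k|).
  by move: (`|_|) (l k ^+ 4) => x y; ring.
by rewrite (_ : 5184 = 36 * 144) // -mulrA ler_pM2l.
Qed.
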